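(* There is a $\Pi_4$ sentence of $\mathcal{L}_{\omega_1\omega}$ in the language $\{\le\}$ extending the theory of linear orders (and having models) such that every countable model of it has Scott complexity at least $\Pi_6$; i.e., no countable model has a Scott sentence that is $\Sigma_6$.
   Context: $\Sigma_0=\Pi_0$ are finitary quantifier-free formulas; for $\alpha\ge1$, $\Sigma_\alpha$ formulas are countable disjunctions $\bigvee_i\exists\bar x_i\psi_i$ with $\psi_i\in\Pi_\beta$, $\beta<\alpha$, and $\Pi_\alpha$ formulas are countable conjunctions $\bigwedge_i\forall\bar x_i\psi_i$ with $\psi_i\in\Sigma_\beta$, $\beta<\alpha$. A Scott sentence of a countable structure $\mathcal{A}$ is a sentence whose countable models are exactly the structures isomorphic to $\mathcal{A}$. Having Scott complexity at least $\Pi_6$ means having no Scott sentence in any complexity class below $\Pi_6$ or incomparable with it, which amounts to having no $\Sigma_6$ Scott sentence. *)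

(* Defs.v *)
From mathcomp Require Import all_boot.

Set Implicit Arguments.
Unset Strict Implicit.
Unset Printing Implicit Defensive.

(* Formulas of L_{omega_1 omega} in the language {<=} with equality; variables
   are named by natural numbers.  Countable families are indexed by all of nat:
   finite ones are obtained by repetition, empty ones by constant families of
   FTrue or FFalse. *)
Inductive formula : Type :=
| FTrue
| FFalse
| FLe (x y : nat)
| FEq (x y : nat)
| FNot (phi : formula)
| FAnd (phi psi : formula)
| FOr (phi psi : formula)
| FConj (phi : nat -> formula)
| FDisj (phi : nat -> formula)
| FAll (x : nat) (phi : formula)
| FEx (x : nat) (phi : formula).

Fixpoint free (v : nat) (phi : formula) : Prop :=
  match phi with
  | FTrue | FFalse => False
  | FLe x y | FEq x y => v = x \/ v = y
  | FNot p => free v p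
  | FAnd p q | FOr p q => free v p \/ free v q
  | FConj f | FDisj f => exists i, free v (f i)
  | FAll x p | FEx x p => v <> x /\ free v p
  end.

Definition sentence (phi : formula) : Prop := forall v, ~ free v phi.

Fixpoint finitary_qf (phi : formula) : bool :=
  match phi with
  | FTrue | FFalse | FLe _ _ | FEq _ _ => true
  | FNot p => finitary_qf p
  | FAnd p q | FOr p q => finitary_qf p && finitary_qf q
  | FConj _ | FDisj _ | FAll _ _ | FEx _ _ => false
  end.

Definition FExs (xs : seq nat) (phi : formula) : formula := foldr FEx phi xs.
Definition FAlls (xs : seq nat) (phi : formula) : formula := foldr FAll phi xs.

(* Only finite levels are needed.  The function b gives the level of each
   member of the family; b i < n forces n >= 1 in the second constructors. *)
Inductive is_Sigma : nat -> formula -> Prop :=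
| Sigma_qf phi : finitary_qf phi -> is_Sigma 0 phi
| Sigma_disj n (b : nat -> nat) (xs : nat -> seq nat) (psi : nat -> formula) :
    (forall i, b i < n) -> (forall i, is_Pi (b i) (psi i)) ->
    is_Sigma n (FDisj (fun i => FExs (xs i) (psi i)))
with is_Pi : nat -> formula -> Prop :=
| Pi_qf phi : finitary_qf phi -> is_Pi 0 phi
| Pi_conj n (b : nat -> nat) (xs : nat -> seq nat) (psi : nat -> formula) :
    (forall i, b i < n) -> (forall i, is_Sigma (b i) (psi i)) ->
    is_Pi n (FConj (fun i => FAlls (xs i) (psi i))).

Record structure : Type := Structure {
  carrier :> Type;
  leS : carrier -> carrier -> Prop;
  structure_inhabited : inhabited carrier
}.

Definition assign (T : Type) (e : nat -> T) (x : nat) (a : T) : nat -> T :=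
  fun y => if y == x then a else e y.

Fixpoint sat (M : structure) (e : nat -> M) (phi : formula) : Prop :=
  match phi with
  | FTrue => True
  | FFalse => False
  | FLe x y => leS (e x) (e y)
  | FEq x y => e x = e y
  | FNot p => ~ sat e p
  | FAnd p q => sat e p /\ sat e q
  | FOr p q => sat e p \/ sat e q
  | FConj f => forall i, sat e (f i)
  | FDisj f => exists i, sat e (f i)
  | FAll x p => forall a : M, sat (assign e x a) p
  | FEx x p => exists a : M, sat (assign e x a) p
  end.

Definition models (M : structure) (phi : formula) : Prop :=
  forall e : nat -> M, sat e phi.

(* Finite structures count as countable. *)
Definition countable_structure (M : structure) : Prop :=
  exists f : M -> nat, injective f.

Definition linear_order (M : structure) : Prop :=
  [/\ forall x : M, leS x x,
      forall x y : M, leS x y -> leS y x -> x = y,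
      forall x y z : M, leS x y -> leS y z -> leS x z
    & forall x y : M, leS x y \/ leS y x].

Definition isomorphic (M N : structure) : Prop :=
  exists f : M -> N, bijective f /\ forall x y, leS x y <-> leS (f x) (f y).

Definition scott_sentence (M : structure) (phi : formula) : Prop :=
  sentence phi /\
  forall N : structure, countable_structure N ->
    (models N phi <-> isomorphic M N).

(* CdSigma n is the class d-Sigma_n of conjunctions of a Sigma_n and a Pi_n
   formula.  The classes of infinite level are omitted: they all lie above
   those of finite level. *)
Inductive complexity : Type :=
| CSigma of nat
| CPi of nat
| CdSigma of nat.

Definition in_class (c : complexity) (phi : formula) : Prop :=
  match c with
  | CSigma n => is_Sigma n phi
  | CPi n => is_Pi n phi
  | CdSigma n =>
      exists p q, [/\ phi = FAnd p q, is_Sigma n p & is_Pi n q]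
  end.

(* Sigma_n, Pi_n < d-Sigma_n < Sigma_n.+1, Pi_n.+1, with Sigma_n and Pi_n
   incomparable for n >= 1; up to equivalence all classes of level 0 coincide. *)
Definition class_le (c d : complexity) : bool :=
  match c, d with
  | CSigma 0, _ | CPi 0, _ | CdSigma 0, _ => true
  | CSigma m, CSigma n | CPi m, CPi n => m <= n
  | CSigma m, CdSigma n | CPi m, CdSigma n | CdSigma m, CdSigma n => m <= n
  | CSigma m, CPi n | CPi m, CSigma n => m < n
  | CdSigma m, CSigma n | CdSigma m, CPi n => m < n
  end.

Definition has_scott_sentence_in (M : structure) (c : complexity) : Prop :=
  exists phi, in_class c phi /\ scott_sentence M phi.

(* "d strictly below c or incomparable with c" is "not c <= d". *)
Definition scott_complexity_at_least (c : complexity) (M : structure) : Prop :=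
  forall d, ~~ class_le c d -> ~ has_scott_sentence_in M d.

(* Main.v *)
(* The sentence describes orders built from two kinds of pieces, densely
   intermixed: blocks of 5 consecutive elements, and groups, i.e. sequences of
   blocks of sizes 2, 3 and 4 separated by dense intervals, which spell an
   infinite binary word.  It asks that different groups spell different words,
   that every finite word begins the word of some group in every interval not
   contained in a single group or block, and that two blocks of size 5 are
   separated by a group.

   Every automorphism of a model [M] fixes the groups, so a block of size 5 is
   determined by the cut it fills among the groups, and deleting one such block
   [z] gives a structure [N] not isomorphic to [M].  But every [Pi_5] sentence
   with parameters outside [z] true in [M] is true in [N].  In the
   back-and-forth game [z] is answered by another block [z'] very close to it;
   then finitely many elements between [z] and [z'] only reveal finite parts of
   groups, which are copied elsewhere.  A [Sigma_6] sentence true in [M] is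
   witnessed by finitely many parameters, and [z] can be chosen to avoid them. *)

Require Import Defs.
From mathcomp Require Import all_boot.
From mathcomp Require Import boolp zify.
From Stdlib Require List.

Set Implicit Arguments.
Unset Strict Implicit.
Unset Printing Implicit Defensive.

(** * Formulas and definable predicates *)

(** Each depth of the game sees a little more. At depth 2, an interval not contained in one group or
    block shows only how far the blocks at its ends reach. A block met inside it can always be
    answered within a block of 5 elements, because the axioms forbid six consecutive elements: this
    is why the deleted block has the largest size. At depth 3 finite prefixes of groups become
    visible. No group can be copied as a whole, since no other group spells its word, but each
    finite prefix can. At depth 4 the block [z] itself is played, and at depth 5 a point of the
    smaller structure is answered by itself. The complexity of the axioms stays low because they
    speak of finite prefixes only. A prefix is described by adjacency (Pi_1) and by density and
    absence of neighbours (Pi_2). To lie in a common group or block, or to begin groups with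
    different words, is then a countable disjunction of existential statements, hence Sigma_3, and
    each axiom is the universal closure of a Sigma_3 condition. *)

Definition upd (T : Type) (xs : seq nat) (c e : nat -> T) : nat -> T :=
  fun v => if v \in xs then c v else e v.

Lemma sat_ext (M : structure) phi (e e' : nat -> M) :
  (forall v, free v phi -> e v = e' v) -> sat e phi <-> sat e' phi.
Proof.
elim: phi e e' => //=.
- by move=> x y e e' H; rewrite (H x) ?(H y) //; [right|left].
- by move=> x y e e' H; rewrite (H x) ?(H y) //; [right|left].
- by move=> p IH e e' H; rewrite (IH _ _ H).
- by move=> p IHp q IHq e e' H; rewrite (IHp e e') ?(IHq e e') // => v fv;
    apply: H; [right|left].
- by move=> p IHp q IHq e e' H; rewrite (IHp e e') ?(IHq e e') // => v fv;
    apply: H; [right|left].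
- move=> f IH e e' H; split=> h i; move: (h i); rewrite (IH i e e') // => v fv;
    by apply: H; exists i.
- move=> f IH e e' H; split=> -[i h]; exists i; move: h;
    rewrite (IH i e e') // => v fv; by apply: H; exists i.
- move=> x p IH e e' H; split=> h a; move: (h a);
    rewrite (IH (assign e x a) (assign e' x a)) // => v fv; rewrite /assign;
    case: eqP => // ne; exact: H.
- move=> x p IH e e' H; split=> -[a h]; exists a; move: h;
    rewrite (IH (assign e x a) (assign e' x a)) // => v fv; rewrite /assign;
    case: eqP => // ne; exact: H.
Qed.

Lemma upd_nil (T : Type) (c e : nat -> T) : upd [::] c e = e.
Proof. exact: funext. Qed.

(** When a variable is repeated, the inner quantifier wins: the value [a] matters only if [x] does
    not recur in [xs]. No distinctness of variables is assumed. *)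
Lemma upd_assign (T : Type) x xs (c e : nat -> T) a :
  upd xs c (assign e x a) = upd (x :: xs) (upd xs c (fun=> a)) e.
Proof.
apply: funext => v; rewrite /upd /assign in_cons.
by case: (v \in xs); rewrite ?orbT ?orbF //; case: eqP.
Qed.

Lemma upd_cons (T : Type) x xs (c e : nat -> T) :
  upd xs c (assign e x (c x)) = upd (x :: xs) c e.
Proof.
apply: funext => v; rewrite /upd /assign in_cons.
by case: (v \in xs); rewrite ?orbT ?orbF //; case: eqP => // ->.
Qed.

Lemma sat_FExs (M : structure) xs phi (e : nat -> M) :
  sat e (FExs xs phi) <-> exists c, sat (upd xs c e) phi.
Proof.
elim: xs e => [|x xs IH] e /=.
  by split=> [h|[c]]; [exists e|]; rewrite upd_nil.
split=> [[a /IH [c h]]|[c h]].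
  by exists (upd xs c (fun=> a)); rewrite -upd_assign.
by exists (c x); apply/IH; exists c; rewrite upd_cons.
Qed.

Lemma sat_FAlls (M : structure) xs phi (e : nat -> M) :
  sat e (FAlls xs phi) <-> forall c, sat (upd xs c e) phi.
Proof.
elim: xs e => [|x xs IH] e /=.
  by split=> [h c|/(_ e)]; rewrite upd_nil.
split=> [h c|h a].
  by rewrite -upd_cons; apply: (iffLR (IH _)); apply: h.
by apply/IH => c; rewrite upd_assign.
Qed.

Lemma free_FExs v xs phi : free v (FExs xs phi) <-> v \notin xs /\ free v phi.
Proof.
elim: xs => [|x xs IH] /=; first by split=> [|[]].
rewrite in_cons negb_or; split=> [[/eqP-> /IH[-> fv]]|[/andP[/eqP ? ?] ?]] //.
by split=> //; apply/IH.
Qed.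

Lemma free_FAlls v xs phi : free v (FAlls xs phi) <-> v \notin xs /\ free v phi.
Proof.
elim: xs => [|x xs IH] /=; first by split=> [|[]].
rewrite in_cons negb_or; split=> [[/eqP-> /IH[-> fv]]|[/andP[/eqP ? ?] ?]] //.
by split=> //; apply/IH.
Qed.

Lemma is_Pi_inv n phi : is_Pi n phi ->
  (n = 0 /\ finitary_qf phi) \/
  exists b xs psi, [/\ forall i, b i < n, forall i, is_Sigma (b i) (psi i) &
    phi = FConj (fun i => FAlls (xs i) (psi i))].
Proof. by case=> [p|m b xs psi hb hp]; [left|right; exists b, xs, psi]. Qed.

Lemma is_Sigma_inv n phi : is_Sigma n phi ->
  (n = 0 /\ finitary_qf phi) \/
  exists b xs psi, [/\ forall i, b i < n, forall i, is_Pi (b i) (psi i) &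
    phi = FDisj (fun i => FExs (xs i) (psi i))].
Proof. by case=> [p|m b xs psi hb hp]; [left|right; exists b, xs, psi]. Qed.

(** The syntactic classes are cumulative except from level 0: a quantifier-free formula is not of
    the form [FConj], hence the first alternative. *)
Lemma is_Pi_mono m n phi : is_Pi m phi -> m <= n ->
  finitary_qf phi \/ is_Pi n phi.
Proof.
move=> /is_Pi_inv[[_ ?] _|[b [xs [psi [hb hp ->]]]] mn]; [by left|right].
by apply: Pi_conj hp => i; apply: leq_trans (hb i) mn.
Qed.

Lemma is_Sigma_mono m n phi : is_Sigma m phi -> m <= n ->
  finitary_qf phi \/ is_Sigma n phi.
Proof.
move=> /is_Sigma_inv[[_ ?] _|[b [xs [psi [hb hp ->]]]] mn]; [by left|right].
by apply: Sigma_disj hp => i; apply: leq_trans (hb i) mn.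
Qed.

(** Above level 0 the classes are not closed under [FNot], so negation is pushed through the
    countable connectives and the quantifier blocks. *)
Lemma negation n :
  (forall phi, is_Pi n phi -> exists psi, [/\ is_Sigma n psi,
     forall v, free v psi -> free v phi &
     forall (M : structure) (e : nat -> M), sat e psi <-> ~ sat e phi]) /\
  (forall phi, is_Sigma n phi -> exists psi, [/\ is_Pi n psi,
     forall v, free v psi -> free v phi &
     forall (M : structure) (e : nat -> M), sat e psi <-> ~ sat e phi]).
Proof.
elim/ltn_ind: n => n IH; split=> phi.
  case/is_Pi_inv=> [[-> qf]|[b [xs [psi [hb hp ->]]]]].
    by exists (FNot phi); split=> //; apply: Sigma_qf.
  have /choice[g hg] i := (IH _ (hb i)).2 _ (hp i).
  exists (FDisj (fun i => FExs (xs i) (g i))); split.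
  - by apply: Sigma_disj hb _ => i; case: (hg i).
  - move=> v /= [i /free_FExs[vx fv]]; exists i; apply/free_FAlls; split=> //.
    by case: (hg i) => _ h _; apply: h.
  - move=> M e /=; split=> [[i /sat_FExs[c h]] /(_ i)/sat_FAlls/(_ c)|/existsNP[i h]].
      by case: (hg i) => _ _ h'; apply/h'.
    exists i; apply/sat_FExs; have /existsNP[c hc] : ~ forall c, sat (upd (xs i) c e) (psi i).
      by move=> h'; apply: h; apply/sat_FAlls.
    by exists c; case: (hg i) => _ _ h'; apply/h'.
case/is_Sigma_inv=> [[-> qf]|[b [xs [psi [hb hp ->]]]]].
  by exists (FNot phi); split=> //; apply: Pi_qf.
have /choice[g hg] i := (IH _ (hb i)).1 _ (hp i).
exists (FConj (fun i => FAlls (xs i) (g i))); split.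
- by apply: Pi_conj hb _ => i; case: (hg i).
- move=> v /= [i /free_FAlls[vx fv]]; exists i; apply/free_FExs; split=> //.
  by case: (hg i) => _ h _; apply: h.
- move=> M e /=; split=> [h [i /sat_FExs[c h']]|h i].
    move: (h i) => /sat_FAlls/(_ c); case: (hg i) => _ _ h''.
    by move/h''.
  apply/sat_FAlls => c; case: (hg i) => _ _ h'; apply/h' => h''.
  by apply: h; exists i; apply/sat_FExs; exists c.
Qed.

(** * Definable predicates *)

Definition spred := forall M : structure, (nat -> M) -> Prop.

(** Formulas are handled through the predicates they define. The bound [K] on the free variables
    leaves every index from [K] on available for new quantifiers. *)
Definition dPi K n (P : spred) : Prop := exists phi,
  [/\ is_Pi n phi, forall v, free v phi -> v < K &
      forall (M : structure) (e : nat -> M), sat e phi <-> P M e].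

Definition dSigma K n (P : spred) : Prop := exists phi,
  [/\ is_Sigma n phi, forall v, free v phi -> v < K &
      forall (M : structure) (e : nat -> M), sat e phi <-> P M e].

Definition mix (T : Type) K (e c : nat -> T) : nat -> T :=
  fun v => if v < K then e v else c v.

Lemma sat_upd_mix (M : structure) K K' phi (e c : nat -> M) :
  (forall v, free v phi -> v < K') ->
  sat (upd (iota K (K' - K)) c e) phi <-> sat (mix K e c) phi.
Proof.
move=> H; apply: sat_ext => v /H vK'; rewrite /upd /mix mem_iota.
case: (ltnP v K) => [|Kv] //=.
by rewrite subnKC ?vK' // (leq_trans Kv) // ltnW.
Qed.

(** The disjuncts may use different numbers [K' i] of variables; each quantifier block binds those
    beyond the first [K]. *)
Lemma dSigma_ex K K' m n (P : nat -> spred) :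
  m < n -> (forall i, dPi (K' i) m (P i)) ->
  dSigma K n (fun M e => exists i c, P i M (mix K e c)).
Proof.
move=> mn /choice[f hf].
exists (FDisj (fun i => FExs (iota K (K' i - K)) (f i))); split.
- by apply: (@Sigma_disj n (fun=> m)) => // i; case: (hf i).
- move=> v /= [i /free_FExs[]]; case: (hf i) => _ h _; rewrite mem_iota => h1 /h.
  move=> vK'; case: (ltnP v K) h1 => //= Kv.
  by rewrite subnKC ?vK' // ltnW // (leq_ltn_trans Kv).
- move=> M e /=; split=> [[i /sat_FExs[c h]]|[i [c h]]]; exists i.
    exists c; case: (hf i) => _ h1 h2; apply/h2; exact: (iffLR (sat_upd_mix _ _ _ h1) h).
  apply/sat_FExs; exists c; case: (hf i) => _ h1 h2.
  by apply: (iffRL (sat_upd_mix _ _ _ h1)); apply/h2.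
Qed.

Lemma dPi_ext K n (P Q : spred) : (forall M e, P M e <-> Q M e) -> dPi K n P -> dPi K n Q.
Proof.
move=> PQ [f [h1 h2 h3]]; exists f; split=> // M e.
by rewrite h3.
Qed.

Lemma dSigma_ext K n (P Q : spred) : (forall M e, P M e <-> Q M e) -> dSigma K n P -> dSigma K n Q.
Proof.
move=> PQ [f [h1 h2 h3]]; exists f; split=> // M e.
by rewrite h3.
Qed.

Lemma dSigma_not K n P : dPi K n P -> dSigma K n (fun M e => ~ P M e).
Proof.
move=> [f [h1 h2 h3]]; have [g [g1 g2 g3]] := (negation n).1 _ h1.
exists g; split=> // [v /g2 /h2 //|M e].
by rewrite g3 h3.
Qed.

Lemma dPi_not K n P : dSigma K n P -> dPi K n (fun M e => ~ P M e).
Proof.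
move=> [f [h1 h2 h3]]; have [g [g1 g2 g3]] := (negation n).2 _ h1.
exists g; split=> // [v /g2 /h2 //|M e].
by rewrite g3 h3.
Qed.

Lemma dPi_all K K' m n (P : nat -> spred) :
  m < n -> (forall i, dSigma (K' i) m (P i)) ->
  dPi K n (fun M e => forall i c, P i M (mix K e c)).
Proof.
move=> mn h.
have := dPi_not (dSigma_ex K mn (fun i => dPi_not (h i))).
apply: dPi_ext => M e; split=> [H i c|H [i [c]]]; last by apply.
by apply: contrapT => nP; apply: H; exists i, c.
Qed.

(** Nested countable disjunctions are flattened along a coding of pairs of indices, so the level
    does not rise. *)
Lemma dSigma_disj K n (P : nat -> spred) : 0 < n ->
  (forall i, dSigma K n (P i)) -> dSigma K n (fun M e => exists i, P i M e).
Proof.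
move=> n0 h.
have /choice[F hF] : forall i, exists F : (nat -> nat) * (nat -> seq nat) * (nat -> formula),
    [/\ forall j, F.1.1 j < n, forall j, is_Pi (F.1.1 j) (F.2 j),
     forall v j, free v (FExs (F.1.2 j) (F.2 j)) -> v < K &
     forall (M : structure) (e : nat -> M),
       (exists j, sat e (FExs (F.1.2 j) (F.2 j))) <-> P i M e].
  move=> i; have [f [h1 h2 h3]] := h i.
  case/is_Sigma_inv: h1 => [[n0' _]|[b [xs [psi [hb hp def]]]]].
    by rewrite n0' in n0.
  exists (b, xs, psi); split=> //= [v j fv|M e]; last by rewrite -h3 def.
  by apply: h2; rewrite def /=; exists j.
(* A number that codes no pair merely repeats the member of index [(0, 0)]. *)
pose G k := odflt (0, 0) (unpickle k : option (nat * nat)).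
exists (FDisj (fun k => FExs ((F (G k).1).1.2 (G k).2) ((F (G k).1).2 (G k).2))); split.
- by apply: (@Sigma_disj n (fun k => (F (G k).1).1.1 (G k).2)) => k; case: (hF (G k).1).
- by move=> v /= [k]; case: (hF (G k).1) => _ _ h3 _; apply: h3.
- move=> M e /=; split=> [[k hk]|[i]].
    by exists (G k).1; case: (hF (G k).1) => _ _ _ <-; exists (G k).2.
  case: (hF i) => _ _ _ <- [j hj]; exists (pickle (i, j)).
  by rewrite /G pickleK.
Qed.

Lemma dPi_conj K n (P : nat -> spred) : 0 < n ->
  (forall i, dPi K n (P i)) -> dPi K n (fun M e => forall i, P i M e).
Proof.
move=> n0 h; have := dPi_not (dSigma_disj n0 (fun i => dSigma_not (h i))).
by apply: dPi_ext => M e; split=> [/forallNP H i|H [i]]; [apply: contrapT; apply: H|apply].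
Qed.

Lemma dPi_and K n P Q : 0 < n -> dPi K n P -> dPi K n Q ->
  dPi K n (fun M e => P M e /\ Q M e).
Proof.
move=> n0 hP hQ.
have := @dPi_conj K n (fun i => if i == 0 then P else Q) n0.
case=> [[|i] //|f [h1 h2 h3]]; exists f; split=> // M e.
by rewrite h3; split=> [H|[p q] [|i] //]; split; [apply: (H 0)|apply: (H 1)].
Qed.

Lemma dSigma_or K n P Q : 0 < n -> dSigma K n P -> dSigma K n Q ->
  dSigma K n (fun M e => P M e \/ Q M e).
Proof.
move=> n0 hP hQ.
have := @dSigma_disj K n (fun i => if i == 0 then P else Q) n0.
case=> [[|i] //|f [h1 h2 h3]]; exists f; split=> // M e.
by rewrite h3; split=> [[[|i]]|[]]; [left|right|exists 0|exists 1].
Qed.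

Lemma dPi_up K K' m n P : K <= K' -> m < n -> dSigma K m P -> dPi K' n P.
Proof.
move=> KK mn [f [h1 h2 h3]]; exists (FConj (fun=> FAlls [::] f)); split.
- exact: (@Pi_conj n (fun=> m)).
- by move=> v /= [_ /h2 h]; apply: leq_trans KK.
- by move=> M e /=; rewrite -h3; split=> [/(_ 0)|].
Qed.

Lemma dSigma_up K K' m n P : K <= K' -> m < n -> dPi K m P -> dSigma K' n P.
Proof.
move=> KK mn [f [h1 h2 h3]]; exists (FDisj (fun=> FExs [::] f)); split.
- exact: (@Sigma_disj n (fun=> m)).
- by move=> v /= [_ /h2 h]; apply: leq_trans KK.
- by move=> M e /=; rewrite -h3; split=> [[]|]; [|exists 0].
Qed.

(** The implication is read as a disjunction with the negation of [P]. A Sigma_n formula with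
    [n > 0] is Sigma_{n+1} as it stands, whereas a quantifier-free one has to be wrapped in a
    disjunction, hence the case split. *)
Lemma dSigma_imp K n P Q : dPi K n P -> dSigma K n.+1 Q ->
  dSigma K n.+1 (fun M e => P M e -> Q M e).
Proof.
case: n => [|n] hP hQ.
  case: hP => f [h1 h2 h3].
  case/is_Pi_inv: h1 => [[_ qf]|[b [xs [psi [hb _ _]]]]]; last by have := hb 0.
  have hN : dSigma K 1 (fun M e => ~ P M e).
    apply: (@dSigma_up K K 0) => //.
    by exists (FNot f); split=> // [|M e /=]; [apply: Pi_qf|rewrite h3].
  have := dSigma_or (ltn0Sn _) hN hQ.
  apply: dSigma_ext => M e; split=> [[]//|H].
  by case: (EM (P M e)) => [/H|]; [right|left].
have hN : dSigma K n.+2 (fun M e => ~ P M e).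
  have [f [h1 h2 h3]] := dSigma_not hP.
  case/is_Sigma_inv: h1 => [[//]|[b [xs [psi [hb hp def]]]]].
  exists f; split=> //; rewrite def; apply: Sigma_disj hp => i.
  exact: ltnW (hb i).
have := dSigma_or (ltn0Sn _) hN hQ.
apply: dSigma_ext => M e; split=> [[]//|H].
by case: (EM (P M e)) => [/H|]; [right|left].
Qed.

(** Used with [n = 3]: it suffices that each axiom be a Sigma_3 condition on finitely many
    variables. *)
Lemma universal_closure n (P : nat -> spred) :
  (forall i, exists K, dSigma K n (P i)) ->
  exists phi, [/\ sentence phi, is_Pi n.+1 phi & forall M : structure,
    models M phi <-> forall i (e : nat -> M), P i M e].
Proof.
move=> /choice[K /choice[f hf]].
exists (FConj (fun i => FAlls (iota 0 (K i)) (f i))); split.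
- move=> v /= [i /free_FAlls[]]; case: (hf i) => _ h _; rewrite mem_iota /= => + /h.
  by rewrite add0n => /negP.
- by apply: (@Pi_conj n.+1 (fun=> n)) => // i; case: (hf i).
- move=> M; split=> [H i e|H e i].
    case: (hf i) => _ h1 h2; apply/h2.
    move: (H e i) => /sat_FAlls/(_ e); apply: (iffLR (sat_ext _)) => v _.
    by rewrite /upd if_same.
  by apply/sat_FAlls => c; case: (hf i) => _ h1 h2; apply/h2.
Qed.

(** * Back-and-forth relations between intervals *)

Definition lt (M : structure) (x y : M) : Prop := leS x y /\ x <> y.

Section Order.
Variables (M : structure) (lin : linear_order M).
Implicit Types x y z : M.

Lemma ltxx x : ~ lt x x. Proof. by case. Qed.

Lemma lt_le x y : lt x y -> leS x y. Proof. by case. Qed.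

Lemma le_refl x : leS x x. Proof. by case: lin. Qed.

Lemma le_trans x y z : leS x y -> leS y z -> leS x z.
Proof. by case: lin => _ _ + _; apply. Qed.

Lemma lt_le_trans x y z : lt x y -> leS y z -> lt x z.
Proof.
case: lin => _ anti tr _ [xy ne] yz; split; first exact: tr xy yz.
by move=> e; subst z; apply: ne; apply: anti.
Qed.

Lemma le_lt_trans x y z : leS x y -> lt y z -> lt x z.
Proof.
case: lin => _ anti tr _ xy [yz ne]; split; first exact: tr xy yz.
by move=> e; subst z; apply: ne; apply: anti.
Qed.

Lemma lt_trans x y z : lt x y -> lt y z -> lt x z.
Proof. by move=> xy /lt_le; apply: lt_le_trans. Qed.

Lemma nle_lt x y : ~ leS x y -> lt y x.
Proof.
case: lin => rf _ _ tot h; case: (tot x y) => // yx; split=> // e.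
by apply: h; rewrite e; apply: rf.
Qed.

Lemma nlt_le x y : ~ lt x y -> leS y x.
Proof. by move=> h; apply: contrapT => /nle_lt. Qed.

Lemma lt_nle x y : lt x y -> ~ leS y x.
Proof. by move=> xy yx; case: (ltxx (lt_le_trans xy yx)). Qed.

Lemma le_eqVlt x y : leS x y -> x = y \/ lt x y.
Proof. by move=> xy; case: (EM (x = y)); [left|right]. Qed.

Lemma le_anti x y : leS x y -> leS y x -> x = y.
Proof. by case: lin => _ + _ _; apply. Qed.

Lemma lt_total x y : [\/ x = y, lt x y | lt y x].
Proof.
case: (EM (leS x y)) => [/le_eqVlt[]|/nle_lt]; [exact: Or31|exact: Or32|exact: Or33].
Qed.

Lemma le_or_lt x y : leS x y \/ lt y x.
Proof. by case: (EM (leS x y)) => [|/nle_lt]; [left|right]. Qed.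

Lemma list_max (P : M -> Prop) l x0 : P x0 ->
  exists x, [/\ P x, x = x0 \/ List.In x l, leS x0 x & forall y, List.In y l -> P y -> leS y x].
Proof.
move=> Px0; elim: l => [|a l [x [Px xl x0x max]]].
  by exists x0; split=> //; [left|apply: le_refl].
case: (EM (P a /\ lt x a)) => [[Pa xa]|h].
  exists a; split=> //; first by right; left.
    exact: le_trans x0x (lt_le xa).
  move=> y [<- _|/max h /h yx]; first exact: le_refl.
  exact: le_trans yx (lt_le xa).
exists x; split=> //; first by case: xl; [left|right; right].
move=> y [<- Pa|]; last exact: max.
by apply: nlt_le => xa; apply: h.
Qed.

Lemma list_min (P : M -> Prop) l x0 : P x0 ->
  exists x, [/\ P x, x = x0 \/ List.In x l, leS x x0 & forall y, List.In y l -> P y -> leS x y].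
Proof.
move=> Px0; elim: l => [|a l [x [Px xl x0x max]]].
  by exists x0; split=> //; [left|apply: le_refl].
case: (EM (P a /\ lt a x)) => [[Pa xa]|h].
  exists a; split=> //; first by right; left.
    exact: le_trans (lt_le xa) x0x.
  move=> y [<- _|/max h /h yx]; first exact: le_refl.
  exact: le_trans (lt_le xa) yx.
exists x; split=> //; first by case: xl; [left|right; right].
move=> y [<- Pa|]; last exact: max.
by apply: nlt_le => xa; apply: h.
Qed.

End Order.

(** * Subdivided intervals and preservation of formulas *)

Section Walk.
Variable X : Type.
Implicit Types R S : X -> X -> Prop.

(** The list [w] gives the cut points of a subdivision; each piece is judged through its end points
    alone. *)
Fixpoint walk R (p : X) (w : seq X) (q : X) : Prop :=
  if w is r :: w' then R p r /\ walk R r w' q else R p q.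

Definition on_walk (p : X) (w : seq X) (q x : X) : Prop :=
  [\/ x = p, x = q | List.In x w].

Lemma walk_cat R p w r w' q :
  walk R p w r -> walk R r w' q -> walk R p (w ++ r :: w') q.
Proof. by elim: w p => [|a w IH] p /= => [//|[pa wr] rq]; split=> //; apply: IH. Qed.

Lemma walk_mono R S p w q : (forall x y, R x y -> S x y) -> walk R p w q -> walk S p w q.
Proof. by move=> RS; elim: w p => [|a w IH] p /=; [apply: RS|case=> /RS ? /IH]. Qed.

End Walk.

Lemma walk_map (X Y : Type) (f : X -> Y) (S : Y -> Y -> Prop) p w q :
  walk (fun x y => S (f x) (f y)) p w q -> walk S (f p) [seq f x | x <- w] (f q).
Proof. by elim: w p => [|a w IH] p //= [pa /IH]. Qed.

Lemma In_mem (s : seq nat) x : List.In x s <-> x \in s.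
Proof.
elim: s => //= a s IH; rewrite in_cons; split=> [[->|/IH->]|/orP[/eqP->|/IH]]; rewrite ?eqxx ?orbT //; auto.
Qed.

Definition swap (A B : Type) (p : A * B) : B * A := (p.2, p.1).

(* [back_forth n p q] compares the open intervals of A and of B cut out by p
   and q: it is the relation usually written <=_n, under which Pi_n sentences
   pass from the A side to the B side. *)
Fixpoint back_forth n (A B : structure) (p q : A * B) : Prop :=
  [/\ lt p.1 q.1, lt p.2 q.2 &
    if n is n'.+1 then
      forall l : seq B, exists w : seq (B * A),
        walk (@back_forth n' B A) (swap p) w (swap q) /\
        forall b, List.In b l -> lt p.2 b -> lt b q.2 -> exists a, List.In (b, a) w
    else True].

Section Transfer.
Variables (A B : structure) (linA : linear_order A) (linB : linear_order B).

Lemma back_forth_lt n (p q : A * B) : back_forth n p q -> lt p.1 q.1 /\ lt p.2 q.2.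
Proof. by case: n => [|n] []. Qed.

Lemma walk_iso n p w q x : walk (@back_forth n A B) p w q -> on_walk p w q x ->
  forall y, on_walk p w q y ->
  [\/ x = y, lt x.1 y.1 /\ lt x.2 y.2 | lt y.1 x.1 /\ lt y.2 x.2].
Proof.
have start : forall w p, walk (@back_forth n A B) p w q -> forall y, on_walk p w q y ->
    y = p \/ lt p.1 y.1 /\ lt p.2 y.2.
  elim=> [|r w' IH] p' /=.
    by move=> /back_forth_lt h y [->|->|//]; [left|right].
  move=> [/back_forth_lt[h1 h2] hw] y [->|yq|yw]; first by left.
    right; case: (IH r hw y); first exact: Or32.
      by move=> ->.
    by move=> [h3 h4]; split; [apply: (lt_trans linA) h3|apply: (lt_trans linB) h4].
  right; case: (IH r hw y); first by case: yw => [<-|]; [apply: Or31|apply: Or33].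
    by move=> ->.
  by move=> [h3 h4]; split; [apply: (lt_trans linA) h3|apply: (lt_trans linB) h4].
elim: w p => [|r w IH] p hw hx y hy.
  case: (start _ _ hw _ hx) (start _ _ hw _ hy) => [-> [->|]|xp [->|yp]].
  - exact: Or31.
  - exact: Or32.
  - exact: Or33.
  - case: hx xp hy yp => [->|->|//] [a _]; first by case: (ltxx a).
    by move=> [->|->|//] [b _]; [case: (ltxx b)|apply: Or31].
case: (start _ _ hw _ hx) (start _ _ hw _ hy) => [-> [->|]|xp [->|yp]].
- exact: Or31.
- exact: Or32.
- exact: Or33.
- case: hw => _ hw; apply: (IH r) => //.
    case: hx xp => [->|->|[<-|?]] [xp _]; [by case: (ltxx xp)|exact: Or32|exact: Or31|exact: Or33].
  case: hy yp => [->|->|[<-|?]] [yp _]; [by case: (ltxx yp)|exact: Or32|exact: Or31|exact: Or33].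
Qed.

(** Each piece answers [l] on its own, and the answers are glued; the matched points survive with
    the two sides exchanged. *)
Lemma walk_refine n p w q (l : seq B) : walk (@back_forth n.+1 A B) p w q ->
  exists w' : seq (B * A), [/\ walk (@back_forth n B A) (swap p) w' (swap q),
    forall x, List.In x w -> List.In (swap x) w' &
    forall b, List.In b l -> lt p.2 b -> lt b q.2 -> exists a, List.In (b, a) w'].
Proof.
elim: w p => [|r w IH] p.
  by case=> _ _ /(_ l)[w' [h1 h2]]; exists w'.
case=> -[_ _ /(_ l)[w1 [h1 h2]]] /IH[w2 [h3 h4 h5]].
exists (w1 ++ swap r :: w2); split.
- exact: walk_cat h1 h3.
- move=> x /= [<-|/h4 hx]; apply: List.in_or_app; right; first by left.
  by right.
- move=> b bl pb bq; case: (lt_total linB b r.2) => [->|br|rb].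
  + by exists r.1; apply: List.in_or_app; right; left.
  + by have [a ha] := h2 b bl pb br; exists a; apply: List.in_or_app; left.
  + by have [a ha] := h5 b bl rb bq; exists a; apply: List.in_or_app; right; right.
Qed.

Lemma qf_transfer n p w q (e : nat -> A) (e' : nat -> B) phi :
  walk (@back_forth n A B) p w q -> finitary_qf phi ->
  (forall v, free v phi -> on_walk p w q (e v, e' v)) -> sat e phi <-> sat e' phi.
Proof.
move=> hw; elim: phi => //=.
- move=> x y _ H.
  case: (walk_iso hw (H x (or_introl erefl)) (H y (or_intror erefl))) => /= [[-> ->]|[h1 h2]|[h1 h2]].
  + by split=> _; apply: le_refl.
  + by split=> _; apply: lt_le.
  + by split=> h; [case: (lt_nle linA h1 h)|case: (lt_nle linB h2 h)].
- move=> x y _ H.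
  case: (walk_iso hw (H x (or_introl erefl)) (H y (or_intror erefl))) => /= [[-> ->]|[h1 h2]|[h1 h2]].
  + by [].
  + by split=> h; rewrite h in h1 h2; [case: (ltxx h1)|case: (ltxx h2)].
  + by split=> h; rewrite h in h1 h2; [case: (ltxx h1)|case: (ltxx h2)].
- by move=> f IH qf H; rewrite IH.
- move=> f IHf g IHg /andP[qf qg] H; rewrite IHf ?IHg // => v fv; apply: H; by [right|left].
- move=> f IHf g IHg /andP[qf qg] H; rewrite IHf ?IHg // => v fv; apply: H; by [right|left].
Qed.

End Transfer.

(** One round of the game: the values [c] of a quantifier block on the side of [B] are put on the
    walk, and their partners there define [c']. *)
Lemma extend_walk n (A B : structure) (linA : linear_order A) (linB : linear_order B)
    (p q : A * B) w (e : nat -> A) (e' : nat -> B) xs psi (c : nat -> B) :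
  (forall b, leS p.2 b /\ leS b q.2) ->
  walk (@back_forth n.+1 A B) p w q ->
  (forall v, free v (FExs xs psi) -> on_walk p w q (e v, e' v)) ->
  exists (w' : seq (B * A)) c', walk (@back_forth n B A) (swap p) w' (swap q) /\
   forall v, free v psi -> on_walk (swap p) w' (swap q) (upd xs c e' v, upd xs c' e v).
Proof.
move=> bd hw H.
have [w' [h1 h2 h3]] := walk_refine linB [seq c v | v <- xs] hw.
have /choice[c' hc'] : forall v, exists a, v \in xs -> on_walk (swap p) w' (swap q) (c v, a).
  move=> v; case: (bd (c v)) => /le_eqVlt[<- _|pv].
    by exists p.1 => _; apply: Or31.
  move=> /le_eqVlt[->|vq]; first by exists q.1 => _; apply: Or32.
  case: (boolP (v \in xs)) => [/In_mem vx|_]; last by exists p.1.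
  have [a ha] := h3 _ (List.in_map c _ _ vx) pv vq.
  by exists a => _; apply: Or33.
exists w', c'; split=> // v fv; rewrite /upd; case: ifPn => [/hc'//|vx].
have /H : free v (FExs xs psi) by apply/free_FExs.
case=> [<-|<-|/h2]; [exact: Or31|exact: Or32|exact: Or33].
Qed.

(** The sides [A] and [B] are exchanged at every step of the induction, so the Pi and Sigma
    statements have to be proved together. As [p] and [q] are the end points of the whole
    structures, every value lies on the walk or inside one of its pieces. *)
Lemma transfer n : forall (A B : structure) (linA : linear_order A) (linB : linear_order B)
    (p q : A * B) w (e : nat -> A) (e' : nat -> B) phi,
  (forall a, leS p.1 a /\ leS a q.1) -> (forall b, leS p.2 b /\ leS b q.2) ->
  walk (@back_forth n A B) p w q ->
  (forall v, free v phi -> on_walk p w q (e v, e' v)) ->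
  (is_Pi n phi -> sat e phi -> sat e' phi) /\
  (is_Sigma n phi -> sat e' phi -> sat e phi).
Proof.
elim: n => [|n IH] A B linA linB p q w e e' phi bdA bdB hw cov.
  by split=> [/is_Pi_inv|/is_Sigma_inv] [[_ qf]|[b [xs [psi [/(_ 0)//]]]]];
    apply: (iffLR (qf_transfer linA linB hw qf cov)) ||
    apply: (iffRL (qf_transfer linA linB hw qf cov)).
split.
  case/is_Pi_inv=> [[//]|[b [xs [psi [hb hp def]]]]]; subst phi => /= H i.
  apply/sat_FAlls => c.
  have cov' v : free v (FExs (xs i) (psi i)) -> on_walk p w q (e v, e' v).
    by move=> /free_FExs fv; apply: cov; exists i; apply/free_FAlls.
  have [w' [c' [hw' hc']]] := extend_walk linA linB c bdB hw cov'.
  have Hi := iffLR (sat_FAlls _ _ _) (H i) c'.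
  case: (is_Sigma_mono (hp i) (hb i)) => [qf|sg].
    exact: (iffRL (qf_transfer linB linA hw' qf hc')).
  exact: ((IH _ _ linB linA (swap p) (swap q) _ _ _ _ bdB bdA hw' hc').2 sg).
case/is_Sigma_inv=> [[//]|[b [xs [psi [hb hp def]]]]]; subst phi => /= -[i].
move=> /sat_FExs[c Hi]; exists i.
have cov' v : free v (FExs (xs i) (psi i)) -> on_walk p w q (e v, e' v).
  by move=> fv; apply: cov; exists i.
have [w' [c' [hw' hc']]] := extend_walk linA linB c bdB hw cov'.
apply/sat_FExs; exists c'.
case: (is_Pi_mono (hp i) (hb i)) => [qf|sg].
  exact: (iffLR (qf_transfer linB linA hw' qf hc')).
exact: ((IH _ _ linB linA (swap p) (swap q) _ _ _ _ bdB bdA hw' hc').1 sg).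
Qed.

(** * Strategies that answer one point at a time *)

Section Refine.
Variables (A B : structure) (linB : linear_order B) (R : B * A -> B * A -> Prop).
Variable Q : B -> Prop.
(** The relation [R] is an invariant that survives the insertion of a point; it is weakened to
    [back_forth] only after a whole list has been inserted. The restriction [Q] serves strategies
    that were fixed with the list already in view. *)
Hypothesis refineR : forall p q b, R p q -> Q b -> lt p.1 b -> lt b q.1 ->
  exists a, R p (b, a) /\ R (b, a) q.

Lemma refine_point w p q b : walk R p w q -> Q b -> lt p.1 b -> lt b q.1 ->
  exists w', [/\ walk R p w' q, forall x, List.In x w -> List.In x w' &
    exists a, List.In (b, a) w'].
Proof.
elim: w p => [|r w IH] p /=.
  move=> Rpq Qb pb bq; have [a [h1 h2]] := refineR Rpq Qb pb bq.
  by exists [:: (b, a)]; split=> //; exists a; left.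
move=> [Rpr hw] Qb pb bq; case: (lt_total linB b r.1) => [->|br|rb].
- exists (r :: w); split=> //; exists r.2; left; by case: r {Rpr hw}.
- have [a [h1 h2]] := refineR Rpr Qb pb br.
  by exists [:: (b, a), r & w]; split=> //; [move=> x h; right|exists a; left].
- have [w' [h1 h2 [a ha]]] := IH _ hw Qb rb bq.
  exists (r :: w'); split=> //; last by exists a; right.
  by move=> x [->|/h2 h]; [left|right].
Qed.

Lemma refine_list l w p q : walk R p w q -> (forall b, List.In b l -> Q b) ->
  exists w', [/\ walk R p w' q, forall x, List.In x w -> List.In x w' &
    forall b, List.In b l -> lt p.1 b -> lt b q.1 -> exists a, List.In (b, a) w'].
Proof.
move=> hw; elim: l => [|b l IH] Ql; first by exists w.
have [w1 [h1 h2 h3]] := IH (fun b' h => Ql b' (or_intror h)).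
case: (EM (lt p.1 b /\ lt b q.1)) => [[pb bq]|nb].
  have [w2 [h4 h5 [a ha]]] := refine_point h1 (Ql b (or_introl erefl)) pb bq.
  exists w2; split=> [//|x /h2 /h5 //|b' [<- _ _|/h3 h /h {}h /h [a' /h5]]]; first by exists a.
  by exists a'.
exists w1; split=> // b' [<- pb bq|]; [by case: nb|exact: h3].
Qed.

Lemma back_forth_refine n w (p q : A * B) :
  lt p.1 q.1 -> lt p.2 q.2 -> (forall x y, R x y -> back_forth n x y) ->
  walk R (swap p) w (swap q) ->
  forall l, (forall b, List.In b l -> Q b) ->
  exists w' : seq (B * A), walk (@back_forth n B A) (swap p) w' (swap q) /\
        forall b, List.In b l -> lt p.2 b -> lt b q.2 -> exists a, List.In (b, a) w'.
Proof.
move=> pq1 pq2 RS hw l Ql; have [w' [h1 h2 h3]] := refine_list hw Ql.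
by exists w'; split=> //; apply: walk_mono h1.
Qed.

End Refine.

Lemma sorting (M : structure) (lin : linear_order M) (l : seq M) :
  exists l', (forall x, List.In x l <-> List.In x l') /\
    (forall l1 x l2, l' = l1 ++ x :: l2 -> forall y, List.In y l2 -> leS x y).
Proof.
elim: l => [|a l [l' [h1 h2]]]; first by exists [::]; split=> // -[].
suff [l'' [h3 h4]] : exists l'', (forall x, x = a \/ List.In x l' <-> List.In x l'') /\
    (forall l1 x l2, l'' = l1 ++ x :: l2 -> forall y, List.In y l2 -> leS x y).
  exists l''; split=> // x; rewrite -h3 /= h1.
  by split=> -[->|]; auto.
elim: l' h2 {l h1} => [|b l IH] srt.
  exists [:: a]; split=> [x|]; first by split=> [[->|//]|[<-|//]]; left.
  by move=> [|? [|? ?]] x [|? ?].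
have srt' : forall l1 x l2, l = l1 ++ x :: l2 -> forall y, List.In y l2 -> leS x y.
  by move=> l1 x l2 e; apply: (srt (b :: l1) x); rewrite e.
case: (le_or_lt lin a b) => ab.
  exists [:: a, b & l]; split=> [x|]; first by split=> [[->|]|[<-|]]; by [left|right].
  move=> [|? l1] x l2 [] => [<- <- y|_ e y]; last exact: srt e y.
  case=> [<-//|yl]; apply: (le_trans lin ab); exact: (srt [::] b l erefl).
have [l'' [h3 h4]] := IH srt'.
exists (b :: l''); split=> [x|].
  split=> [[xa|[<-|xl]]|[<-|/h3[]]].
  - by right; apply/h3; left.
  - by left.
  - by right; apply/h3; right.
  - by right; left.
  - by left.
  - by right; right.
move=> [|? l1] x l2 [] => [<- <- y|_ e y]; last exact: h4 e y.
move=> /h3[->|yl]; first exact: lt_le.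
exact: (srt [::] b l erefl).
Qed.

(** * Blocks, groups and the axioms *)

Section Predicates.
Variable M : structure.
Implicit Types x y : M.

Definition adj x y := lt x y /\ forall w, ~ (lt x w /\ lt w y).

Definition cdense x y :=
  lt x y /\ forall s t, leS x s -> lt s t -> leS t y -> exists r, lt s r /\ lt r t.

Definition nopred x := forall y, lt y x -> exists w, lt y w /\ lt w x.

Definition nosucc x := forall y, lt x y -> exists w, lt x w /\ lt w y.

Definition step (k : bool) x y := if k then adj x y else cdense x y.

End Predicates.

(* A bit is written as two maximal finite blocks, each preceded by a dense
   interval: [true] by blocks of sizes 2 and 3, [false] by sizes 3 and 2. *)
Definition bit_kind (b : bool) (j : nat) : bool :=
  nth true (if b then [:: false; true; false; true; true]
            else [:: false; true; true; false; true]) j.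

(* Consecutive points of a group with bits [p] are adjacent ([true]) or bound a
   dense interval ([false]); a group starts with a block of size 4. *)
Definition kind (p : nat -> bool) (i : nat) : bool :=
  (i < 3) || bit_kind (p ((i - 3) %/ 5)) ((i - 3) %% 5).

(* [None] stands for a block of size 5, and [Some w] for the part of a group
   spelling the word [w]. *)
Definition label := option (seq bool).

Definition pat_size (o : label) : nat := if o is Some w then 3 + 5 * size w else 4.

Definition pat_kind (o : label) (i : nat) : bool :=
  if o is Some w then kind (nth false w) i else true.

Section Patterns.
Variable M : structure.
Implicit Types x y : M.

(** Ending with [nosucc] makes the last block complete. Since a bit begins with a dense interval,
    points that spell a word also satisfy the patterns of its prefixes, and an infinite word is
    described through finite ones. *)
Definition pat (o : label) (c : nat -> M) :=
  [/\ nopred (c 0), nosucc (c (pat_size o)) &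
      forall i, i < pat_size o -> step (pat_kind o i) (c i) (c i.+1)].

Definition item x y :=
  exists o c, [/\ pat o c, leS (c 0) x & leS y (c (pat_size o))].

End Patterns.

(** With end points, the whole structure is one interval of the game. The least point has no
    successor and so lies in no item, which provides rich intervals to start from. In [th_group] the
    words have equal length, so that they differ at some bit and neither is a mere prefix of the
    other. *)
Record theory (M : structure) : Prop := Theory {
  th_lin : linear_order M;
  th_bot : exists x : M, (forall y, leS x y) /\ nosucc x;
  th_top : exists x : M, (forall y, leS y x) /\ exists y, lt y x;
  th_five : forall c : nat -> M, ~ forall i, i < 5 -> adj (c i) (c i.+1);
  th_item : forall x : M, [\/ forall y, leS x y, forall y, leS y x | item x x];
  th_rich : forall o (x y : M), lt x y -> item x y \/
    exists c, [/\ pat o c, lt x (c 0) & lt (c (pat_size o)) y];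
  th_group : forall c c' : nat -> M, pat (Some [::]) c -> pat (Some [::]) c' ->
    lt (c 0) (c' 0) -> exists w w' (d d' : nat -> M),
      [/\ size w = size w', w <> w', pat (Some w) d, pat (Some w') d' &
          d 0 = c 0 /\ d' 0 = c' 0];
  th_zero : forall c c' : nat -> M, pat None c -> pat None c' -> lt (c 0) (c' 0) ->
    exists d, [/\ pat (Some [::]) d, lt (c 0) (d 0) & lt (d 0) (c' 0)]
}.

(** Bits use blocks of sizes 2 and 3 only, so three adjacencies in a row, that is a block of size 4,
    mark the start of a group. *)
Lemma kind_aaa p i : 0 < i -> kind p i -> kind p i.+1 -> kind p i.+2 -> False.
Proof.
rewrite /kind => i0.
case: (ltnP i 3) => [i3|i3].
  by case: i i0 i3 => [|[|[|i]]] //=; case: (p _).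
have -> : (i.+1 < 3) = false by lia.
have -> : (i.+2 < 3) = false by lia.
rewrite /=.
have [j def] : exists j, i = j + 3 by exists (i - 3); rewrite subnK.
rewrite {}def {i0 i3} addnK (_ : (j + 3).+1 - 3 = j + 1); last by lia.
rewrite (_ : (j + 3).+2 - 3 = j + 2); last by lia.
rewrite (divn_eq j 5); move: (j %/ 5) (ltn_pmod j (isT : 0 < 5)) => a; move: (j %% 5) => b.
rewrite -!addnA !modnMDl !divnMDl //.
by case: b => [|[|[|[|[|b]]]]] //= _; rewrite ?addn0; do 3?[case: (p _) => //].
Qed.

(** Place 2 of a bit tells its value: [true] has its second dense interval there, [false] is still
    inside its block of size 3. *)
Lemma kind_bit p a : kind p (3 + 5 * a + 2) = ~~ p a.
Proof.
rewrite /kind (_ : 3 + 5 * a + 2 - 3 = a * 5 + 2); last by lia.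
rewrite divnMDl // modnMDl /= addn0.
by case: (p a).
Qed.

Lemma kind_dense p n i : i < 3 + 5 * n -> ~~ kind p i ->
  i.+1 < 3 + 5 * n /\ kind p i.+1.
Proof.
move=> hi; rewrite /kind negb_or -leqNgt => /andP[i3].
have [j def] : exists j, i = j + 3 by exists (i - 3); rewrite subnK.
move: hi; rewrite {}def {i3} addnK (_ : (j + 3).+1 - 3 = j + 1); last by lia.
rewrite (divn_eq j 5); move: (j %/ 5) (ltn_pmod j (isT : 0 < 5)) => a; move: (j %% 5) => b.
rewrite -!addnA !modnMDl !divnMDl //.
case: b => [|[|[|[|[|b]]]]] //= _; rewrite ?addn0 => h; case: (p _) => // _;
  split; by [lia | apply/orP; right].
Qed.

Lemma kind_three p : kind p 3 = false.
Proof. by rewrite /kind /= subnn div0n; case: (p 0). Qed.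

Lemma pat_kind_dense o i : i < pat_size o -> ~~ pat_kind o i ->
  i.+1 < pat_size o /\ pat_kind o i.+1.
Proof. by case: o => [w|//]; apply: kind_dense. Qed.

Lemma pat_kind_start o i : i < 3 -> i < pat_size o /\ pat_kind o i.
Proof.
case: o => [w|] i3 /=; last by split=> //; apply: ltn_trans i3 _.
by rewrite /kind i3 (leq_trans i3) // leq_addr.
Qed.

Section OrderFacts.
Variables (M : structure) (lin : linear_order M).
Implicit Types x y z : M.

Lemma adj_le x y z : adj x y -> lt x z -> leS y z.
Proof. by move=> [_ h] xz; apply: (nlt_le lin) => zy; apply: (h z). Qed.

Lemma adj_ge x y z : adj x y -> lt z y -> leS z x.
Proof. by move=> [_ h] zy; apply: (nlt_le lin) => xz; apply: (h z). Qed.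

Lemma adj_fun x y z : adj x y -> adj x z -> y = z.
Proof.
move=> h h'; apply: (le_anti lin); first by apply: adj_le h _; case: h'.
by apply: adj_le h' _; case: h.
Qed.

Lemma adj_inj x y z : adj x z -> adj y z -> x = y.
Proof.
move=> h h'; apply: (le_anti lin); first by apply: adj_ge h' _; case: h.
by apply: adj_ge h _; case: h'.
Qed.

Lemma nosucc_adj x y : nosucc x -> adj x y -> False.
Proof. by move=> h [xy h']; have [w hw] := h _ xy; apply: (h' w). Qed.

Lemma nopred_adj x y : nopred y -> adj x y -> False.
Proof. by move=> h [xy h']; have [w hw] := h _ xy; apply: (h' w). Qed.

Lemma nadj_nosucc x : (forall y, ~ adj x y) -> nosucc x.
Proof.
move=> h y xy; apply: contrapT => h'; apply: (h y); split=> // w hw.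
by apply: h'; exists w.
Qed.

Lemma nadj_nopred x : (forall y, ~ adj y x) -> nopred x.
Proof.
move=> h y xy; apply: contrapT => h'; apply: (h y); split=> // w hw.
by apply: h'; exists w.
Qed.

Lemma cdense_nadj x y s t : cdense x y -> leS x s -> adj s t -> leS t y -> False.
Proof. by move=> [_ h] xs [st h'] ty; have [r hr] := h s t xs st ty; apply: (h' r). Qed.

Lemma cdense_nadjl x y z : cdense x y -> adj x z -> False.
Proof.
move=> h h'; apply: (cdense_nadj h (le_refl lin x) h').
by apply: adj_le h' _; case: h.
Qed.

Lemma cdense_sub x y s t : cdense x y -> leS x s -> lt s t -> leS t y -> cdense s t.
Proof.
move=> [_ h] xs st ty; split=> // a b sa ab bt.
by apply: h => //; [apply: (le_trans lin) xs sa|apply: (le_trans lin) bt ty].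
Qed.

Lemma step_lt k x y : step k x y -> lt x y.
Proof. by case: k => -[]. Qed.

Fixpoint after k x y : Prop :=
  if k is k'.+1 then exists2 z, adj x z & after k' z y else x = y.

Lemma after_le k x y : after k x y -> leS x y.
Proof.
elim: k x => [x ->|k IH x [z [[xz _] _] /IH]]; first exact: le_refl.
exact: (le_trans lin).
Qed.

Lemma after_lt k x y : after k.+1 x y -> lt x y.
Proof. by move=> [z [xz _] /after_le]; apply: lt_le_trans. Qed.

Lemma after_cat j k x y z : after j x y -> after k y z -> after (j + k) x z.
Proof.
elim: j x => [x ->|j IH x [u xu uy] yz] //=.
by exists u => //; apply: IH.
Qed.

Lemma after_split j k x z : after (j + k) x z -> exists2 y, after j x y & after k y z.
Proof.
elim: j x => [x h|j IH x /= [u xu /IH[y uy yz]]]; first by exists x.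
by exists y => //; exists u.
Qed.

Lemma after_fun k x y z : after k x y -> after k x z -> y = z.
Proof.
elim: k x => [x <- <- //|k IH x [u xu uy] [v xv]].
by rewrite -(adj_fun xu xv); apply: IH.
Qed.

Lemma after_inj k x y z : after k x z -> after k y z -> x = y.
Proof.
elim: k z => [z /= -> //|k IH z].
rewrite -addn1 => /after_split[u xu [u' uz /= e]] /after_split[v yv [v' vz /= e']].
by subst u' v'; apply: IH xu _; rewrite (adj_inj uz vz).
Qed.

Lemma after_between k x y z : after k x y -> leS x z -> leS z y ->
  exists i j, [/\ k = i + j, after i x z & after j z y].
Proof.
elim: k x => [x /= <- xz zx|k IH x [u xu uy] xz zy].
  by exists 0, 0; split=> //=; apply: (le_anti lin).
case: (le_eqVlt xz) => [<-|{}xz].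
  by exists 0, k.+1; split=> //; exists u.
have [i [j [-> h1 h2]]] := IH _ uy (adj_le xu xz) zy.
by exists i.+1, j; split=> //; exists u.
Qed.

Lemma after_seq k x y : after k x y ->
  exists c : nat -> M, [/\ c 0 = x, c k = y & forall i, i < k -> adj (c i) (c i.+1)].
Proof.
elim: k x => [x /= <-|k IH x [u xu /IH[c [h1 h2 h3]]]]; first by exists (fun=> x).
exists (fun i => if i is i'.+1 then c i' else x); split=> //.
by case=> [|i] // ik; [rewrite h1|apply: h3].
Qed.

Lemma seq_after (c : nat -> M) i k : (forall j, i <= j -> j < i + k -> adj (c j) (c j.+1)) ->
  after k (c i) (c (i + k)).
Proof.
elim: k i => [|k IH] i h; first by rewrite addn0.
exists (c i.+1); first by apply: h => //; lia.
by rewrite -addSnnS; apply: IH => j ij jk; apply: h; lia.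
Qed.

Lemma pat_lt o (c : nat -> M) i j : pat o c -> i < j -> j <= pat_size o -> lt (c i) (c j).
Proof.
move=> [_ _ h]; elim: j => // j IH; rewrite ltnS leq_eqVlt => /orP[/eqP->|ij] js.
  exact: step_lt (h _ js).
exact: (lt_trans lin) (IH ij (ltnW js)) (step_lt (h _ js)).
Qed.

Lemma pat_le o (c : nat -> M) i j : pat o c -> i <= j -> j <= pat_size o -> leS (c i) (c j).
Proof.
move=> h; rewrite leq_eqVlt => /orP[/eqP-> _|ij js]; first exact: le_refl.
exact: lt_le (pat_lt h ij js).
Qed.

Lemma locate (c : nat -> M) n x : leS (c 0) x -> leS x (c n) ->
  x = c 0 \/ exists2 i, i < n & lt (c i) x /\ leS x (c i.+1).
Proof.
move=> cx; elim: n => [|n IH] xc; first by left; apply: (le_anti lin).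
case: (le_or_lt lin x (c n)) => [/IH[->|[i h1 h2]]|h]; first by left.
  by right; exists i => //; apply: ltnW.
by right; exists n.
Qed.

(** The points are determined one after the other: successors are unique, and the right end of a
    dense interval is the first point beyond its left end that has a successor, by [pat_kind_dense].
    So the word of a group depends on its start only. *)
Lemma pat_agree o o' (c c' : nat -> M) i : pat o c -> pat o' c' -> c 0 = c' 0 ->
  i <= pat_size o -> i <= pat_size o' ->
  c i = c' i /\ forall j, j < i -> pat_kind o j = pat_kind o' j.
Proof.
move=> [_ _ h] [_ _ h'] e0; elim: i => [|i IH] io io'; first by split.
have [e k] := IH (ltnW io) (ltnW io').
move: (h _ io) (h' _ io'); rewrite -e /step.
have kk : pat_kind o i = pat_kind o' i -> forall j, j < i.+1 -> pat_kind o j = pat_kind o' j.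
  by move=> ki j; rewrite ltnS leq_eqVlt => /orP[/eqP->|/k].
case k1 : (pat_kind o i); case k2 : (pat_kind o' i) => h1 h2.
- by split; [apply: adj_fun h1 h2|apply: kk; rewrite k1 k2].
- by case: (cdense_nadjl h2 h1).
- by case: (cdense_nadjl h1 h2).
- split; last by apply: kk; rewrite k1 k2.
  have [l1 k1'] := pat_kind_dense io (negbT k1).
  have [l2 k2'] := pat_kind_dense io' (negbT k2).
  move: (h _ l1) (h' _ l2); rewrite /step k1' k2' => a1 a2.
  case: (lt_total lin (c i.+1) (c' i.+1)) => // hlt.
    case: (cdense_nadj h2 _ a1); first by apply: lt_le; case: h1.
    exact: adj_le a1 hlt.
  case: (cdense_nadj h1 _ a2); first by apply: lt_le; case: h2.
  exact: adj_le a2 hlt.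
Qed.

(* A start is followed by three adjacencies, which never occurs later inside a
   pattern. *)
Lemma pat_start o o' (c c' : nat -> M) : pat o c -> pat o' c' ->
  leS (c 0) (c' 0) -> leS (c' 0) (c (pat_size o)) -> c 0 = c' 0.
Proof.
move=> hc hc' h1 h2; have [_ ns h] := hc; have [np' _ h'] := hc'.
case: (locate h1 h2) => [//|[i io [ix xi]]].
have ad' j : j < 3 -> adj (c' j) (c' j.+1).
  by move=> j3; have [s k] := pat_kind_start o' j3; move: (h' _ s); rewrite /step k.
move: (h _ io); rewrite /step; case k : (pat_kind o i) => hi.
  have e : c' 0 = c i.+1 by apply: (le_anti lin) => //; apply: adj_le hi ix.
  by rewrite -e in hi; case: (nopred_adj np' hi).
have e : c' 0 = c i.+1.
  case: (le_eqVlt xi) => // lti.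
  case: (cdense_nadj hi (lt_le ix) (ad' 0 isT)); exact: adj_le (ad' 0 isT) lti.
have next j : j < 3 -> i + j < pat_size o -> c' j = c (i + j).+1 ->
    [/\ i + j.+1 < pat_size o, pat_kind o (i + j.+1) & c' j.+1 = c (i + j.+1).+1].
  move=> j3 jo ej; have aj := ad' j j3; rewrite ej in aj.
  have lj : i + j.+1 < pat_size o.
    rewrite addnS; rewrite leq_eqVlt in jo; case/orP: jo => // /eqP jo.
    by rewrite jo in aj; case: (nosucc_adj ns aj).
  move: (h _ lj); rewrite /step; case kj : (pat_kind o (i + j.+1)) => hj.
    by split=> //; move: aj hj; rewrite -addnS => aj hj; apply: adj_fun aj hj.
  by move: aj hj; rewrite -addnS => aj hj; case: (cdense_nadjl hj aj).
have [l1 k1 e1] : [/\ i + 1 < pat_size o, pat_kind o (i + 1) & c' 1 = c (i + 1).+1].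
  by apply: (next 0); rewrite ?addn0.
have [l2 k2 e2] := next 1 isT l1 e1.
have [l3 k3 e3] := next 2 isT l2 e2.
case: o k k1 k2 k3 {h hc ns h2 io l1 l2 l3 next} => [w|//] k k1 k2 k3.
rewrite /= addn1 in k1; rewrite /= addn2 in k2; rewrite /= addn3 in k3.
by case: (kind_aaa (ltn0Sn i) k1 k2 k3).
Qed.

(** By [pat_start] both patterns have the same start; a group is excluded because its first block
    stops after 4 points. *)
Lemma zero_item o (c z : nat -> M) u : pat None z -> pat o c ->
  leS (c 0) u -> leS u (c (pat_size o)) -> leS (z 0) u -> leS u (z 4) ->
  c 0 = z 0 /\ c (pat_size o) = z 4.
Proof.
move=> hz hc cu uc zu uz.
have e : c 0 = z 0.
  case: (le_or_lt lin (c 0) (z 0)) => h.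
    by apply: pat_start hc hz h _; apply: (le_trans lin) zu uc.
  by apply/esym; apply: pat_start hz hc (lt_le h) _; apply: (le_trans lin) cu uz.
split=> //; case: o hc {cu uc} => [w|] hc; last first.
  by case: (pat_agree hc hz e (leqnn _) (leqnn _)).
case: w hc => [|b w] hc.
  have [e3 _] := pat_agree hc hz e (leqnn 3) (isT : 3 <= 4).
  have [_ ns _] := hc; have [_ _ /(_ 3 isT)] := hz.
  by rewrite /step /= -e3 => /(nosucc_adj ns).
have l4 : 4 <= pat_size (Some (b :: w)) by rewrite /=; lia.
have [_ /(_ 3 isT)] := pat_agree hc hz e l4 (leqnn 4).
by rewrite /= kind_three.
Qed.

End OrderFacts.

(** * Models of the axioms *)

Lemma walk_seq (X : Type) (R : X -> X -> Prop) (f : nat -> X) a n :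
  (forall i, a <= i -> i <= a + n -> R (f i) (f i.+1)) ->
  walk R (f a) [seq f i | i <- iota a.+1 n] (f (a + n).+1).
Proof.
elim: n a => [|n IH] a h /=; first by rewrite addn0; apply: h; rewrite ?addn0.
split; first by apply: h => //; lia.
by rewrite addnS -addSn; apply: IH => i ai ia; apply: h; lia.
Qed.

Section Model.
Variables (M : structure) (th : theory M).
Implicit Types x y m n : M.
Let lin : linear_order M := th_lin th.

Definition rich x y := lt x y /\ ~ item x y.

Lemma rich_pat o x y : rich x y ->
  exists c, [/\ pat o c, lt x (c 0) & lt (c (pat_size o)) y].
Proof. by move=> [xy ni]; case: (th_rich th o xy). Qed.

Lemma bottom_nosucc x : (forall y, leS x y) -> nosucc x.
Proof.
by move=> h; have [b [hb ns]] := th_bot th; rewrite (le_anti lin (h b) (hb x)).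
Qed.

Lemma pat_adj0 o (c : nat -> M) : pat o c -> adj (c 0) (c 1).
Proof.
move=> [_ _ h]; have [s k] := pat_kind_start o (isT : 0 < 3).
by move: (h _ s); rewrite /step k.
Qed.

Lemma bottom_rich x y : (forall y, leS x y) -> lt x y -> rich x y.
Proof.
move=> hx xy; split=> // -[o [c [hc cx _]]].
have e := le_anti lin cx (hx _); have := pat_adj0 hc; rewrite e.
exact: nosucc_adj (bottom_nosucc hx).
Qed.

(** An item meeting the block [z] is [z] itself, so none reaches into it from outside. *)
Lemma zero_rich_r (z : nat -> M) x i : pat None z -> i <= 4 -> lt x (z 0) -> rich x (z i).
Proof.
move=> hz i4 xz; split.
  by apply: (lt_le_trans lin) xz _; apply: (pat_le lin hz).
move=> [o [c [hc cx zc]]].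
have zi := pat_le lin hz (leq0n i) i4.
have [e _] := zero_item lin hz hc (le_trans lin cx (le_trans lin (lt_le xz) zi)) zc zi
  (pat_le lin hz i4 (leqnn _)).
by rewrite e in cx; apply: (lt_nle lin xz cx).
Qed.

Lemma zero_rich_l (z : nat -> M) y i : pat None z -> i <= 4 -> lt (z 4) y -> rich (z i) y.
Proof.
move=> hz i4 zy; split.
  by apply: (le_lt_trans lin) _ zy; apply: (pat_le lin hz).
move=> [o [c [hc cz yc]]].
have zi := pat_le lin hz i4 (leqnn _).
have [_ e] := zero_item lin hz hc cz (le_trans lin zi (le_trans lin (lt_le zy) yc))
  (pat_le lin hz (leq0n i) i4) zi.
by rewrite e in yc; apply: (lt_nle lin zy yc).
Qed.

Lemma after_five x y : ~ after 5 x y.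
Proof. by move=> /after_seq[c [_ _ h]]; apply: (th_five th h). Qed.

Lemma nosucc_after k x y : nosucc x -> after k x y -> k = 0.
Proof. by case: k => // k ns [z /(nosucc_adj ns)]. Qed.

Lemma nopred_after k x y : nopred y -> after k x y -> k = 0.
Proof.
case: k => // k np; rewrite -addn1 => /after_split[z _ [u zu /= e]].
by rewrite e in zu; case: (nopred_adj np zu).
Qed.

Lemma nosucc_after_eq k x y : nosucc x -> after k x y -> x = y.
Proof. by move=> ns h; have k0 := nosucc_after ns h; rewrite k0 in h. Qed.

Lemma nopred_after_eq k x y : nopred y -> after k x y -> x = y.
Proof. by move=> np h; have k0 := nopred_after np h; rewrite k0 in h. Qed.

Lemma after_ltk k x y x' y' : after k x y -> lt x y -> after k x' y' -> lt x' y'.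
Proof. by case: k => [/= -> /ltxx//|k _ _]; apply: after_lt. Qed.

(** The start of an item has no predecessor, so going back through finitely many adjacencies does
    not leave the item. *)
Lemma item_after_l k x x' y : after k x x' -> leS x' y -> item x' y -> item x y.
Proof.
move=> a x'y [o [c [hc cx yc]]]; exists o, c; split=> //.
case: (le_or_lt lin (c 0) x) => // h.
have [i [j [_ ai _]]] := after_between lin a (lt_le h) cx.
have [np _ _] := hc.
by rewrite (nopred_after_eq np ai) in h; case: (ltxx h).
Qed.

Lemma item_after_r k x y y' : after k y' y -> leS x y' -> item x y' -> item x y.
Proof.
move=> a xy' [o [c [hc cx yc]]]; exists o, c; split=> //.
case: (le_or_lt lin y (c (pat_size o))) => // h.
have [i [j [_ _ aj]]] := after_between lin a yc (lt_le h).
have [_ ns _] := hc.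
by rewrite (nosucc_after_eq ns aj) in h; case: (ltxx h).
Qed.

Lemma after_item k x y : lt x y -> after k x y -> item x y.
Proof.
move=> xy a; case: (th_item th x) => [hx|hx|ix].
- by move: xy; rewrite (nosucc_after_eq (bottom_nosucc hx) a) => /ltxx.
- by case: (lt_nle lin xy (hx y)).
- exact: item_after_r a (le_refl lin x) ix.
Qed.

Lemma block_last x : exists i y, after i x y /\ nosucc y.
Proof.
apply: contrapT => h.
have {}h i : exists y, after i x y.
  elim: i => [|i [y a]]; first by exists x.
  have [z yz] : exists z, adj y z.
    apply: contrapT => h'; apply: h; exists i, y; split=> //.
    by apply: nadj_nosucc => z yz; apply: h'; exists z.
  by exists z; rewrite -addn1; apply: after_cat a _; exists z.
by have [y] := h 5; apply: after_five.
Qed.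

Lemma block_first x : exists i y, after i y x /\ nopred y.
Proof.
apply: contrapT => h.
have {}h i : exists y, after i y x.
  elim: i => [|i [y a]]; first by exists x.
  have [z yz] : exists z, adj z y.
    apply: contrapT => h'; apply: h; exists i, y; split=> //.
    by apply: nadj_nopred => z yz; apply: h'; exists z.
  by exists z; exists y.
by have [y] := h 5; apply: after_five.
Qed.

(** Any point between the last element of the block of [x] and the first element of the block of [y]
    will do. *)
Lemma far_between x y : lt x y -> (forall k, ~ after k x y) ->
  exists z, [/\ lt x z, lt z y, forall k, ~ after k x z & forall k, ~ after k z y].
Proof.
move=> xy far.
have [i [u [xu nsu]]] := block_last x; have [j [v [vy npv]]] := block_first y.
have uy : lt u y.
  case: (le_or_lt lin y u) => // yu.
  by have [i' [j' [_ /far]]] := after_between lin xu (lt_le xy) yu.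
have uv : lt u v.
  case: (le_or_lt lin v u) => // vu.
  have [i' [j' [_ _ a]]] := after_between lin vy vu (lt_le uy).
  by move: uy; rewrite (nosucc_after_eq nsu a) => /ltxx.
have [z [uz zv]] := nsu _ uv; exists z; split.
- exact: (le_lt_trans lin) (after_le lin xu) uz.
- exact: (lt_le_trans lin) zv (after_le lin vy).
- move=> k a; have [i' [k' [_ _ a']]] := after_between lin a (after_le lin xu) (lt_le uz).
  by move: uz; rewrite (nosucc_after_eq nsu a') => /ltxx.
- move=> k a; have [k' [j' [_ a' _]]] := after_between lin a (lt_le zv) (after_le lin vy).
  by move: zv; rewrite (nopred_after_eq npv a') => /ltxx.
Qed.

(* The block [z] of size 5 is deleted; below, points called [n] lie in the
   remaining structure and points called [m] in [M]. *)
Variables (z : nat -> M) (hz : pat None z).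

Definition deleted x := leS (z 0) x /\ leS x (z 4).

Lemma deleted_adj x y : adj x y -> deleted x <-> deleted y.
Proof.
have [np ns _] := hz; move=> xy; split=> -[h1 h2]; split.
- by apply: (le_trans lin) h1 _; apply: lt_le; case: xy.
- case: (le_eqVlt h2) => [e|h]; last exact: adj_le xy h.
  by rewrite e in xy; case: (nosucc_adj ns xy).
- case: (le_eqVlt h1) => [e|h]; last exact: adj_ge xy h.
  by rewrite -e in xy; case: (nopred_adj np xy).
- by apply: (le_trans lin) _ h2; apply: lt_le; case: xy.
Qed.

Lemma deleted_after k x y : after k x y -> deleted x <-> deleted y.
Proof.
elim: k x => [x /= -> //|k IH x [u xu /IH <-]]; exact: deleted_adj.
Qed.

Lemma bottom_kept x : (forall y, leS x y) -> ~ deleted x.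
Proof.
move=> hx [zx _]; have e := le_anti lin zx (hx _).
by have := pat_adj0 hz; rewrite e; apply: nosucc_adj (bottom_nosucc hx).
Qed.

Lemma kept_inhabited : inhabited {x : M | ~ deleted x}.
Proof.
by have [b [hb _]] := th_bot th; constructor; exists b; apply: bottom_kept.
Qed.

Definition remainder_le (x y : {x : M | ~ deleted x}) : Prop :=
  @leS M (proj1_sig x) (proj1_sig y).

Definition remainder : structure := Structure remainder_le kept_inhabited.

Notation N := remainder.

Definition point (p : N) : M := @proj1_sig M (fun x => ~ deleted x) p.

Lemma point_kept (p : N) : ~ deleted (point p).
Proof. exact: (@proj2_sig M (fun x => ~ deleted x) p). Qed.

Lemma point_inj (p p' : N) : point p = point p' -> p = p'.
Proof.
case: p p' => [x hx] [y hy] /= e; rewrite /point /= in e; subst y.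
by congr exist; apply: Prop_irrelevance.
Qed.

Lemma point_le (p p' : N) : leS p p' <-> leS (point p) (point p').
Proof. by []. Qed.

Lemma point_lt (p p' : N) : lt p p' <-> lt (point p) (point p').
Proof.
split=> -[h1 h2]; split=> //; first by move=> /point_inj.
by move=> e; apply: h2; rewrite e.
Qed.

Lemma point_surj x : ~ deleted x -> exists p : N, point p = x.
Proof. by move=> h; exists (exist (fun x => ~ deleted x) x h). Qed.

Lemma remainder_lin : linear_order N.
Proof.
case: lin => rf an tr tt; split.
- by move=> x; apply: rf.
- by move=> x y xy yx; apply: point_inj; apply: an.
- by move=> x y w; apply: tr.
- by move=> x y; apply: tt.
Qed.

(** * Invariants for depths 1 and 2 *)

Definition same n m n' m' :=
  [/\ n = m, n' = m' & forall x, deleted x -> lt n x -> lt x n' -> False].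

(** For kept points, too, [after], and below [cdense] and [rich], are taken in [M]; this is
    harmless, as [back_forth] concerns only the order of the points. *)
Definition J1 m n m' n' := [/\ lt m m', lt n n' &
  (forall k, ~ after k m m') \/ exists k, after k m m' /\ after k n n'].

Definition more_after n m := forall k y, after k m y -> exists y', after k n y'.
Definition more_before n m := forall k y, after k y m -> exists y', after k y' n.

(** All that depth 2 sees of a long interval is the blocks at its two ends; those of the remainder
    have to reach at least as far as those of [M]. *)
Definition wide n m n' m' :=
  [/\ rich n n', forall k, ~ after k m m', more_after n m & more_before n' m'].

Definition J2 n m n' m' := [/\ lt n n', lt m m' &
  [\/ same n m n' m', exists k, after k n n' /\ after k m m',
      cdense n n' /\ cdense m m' | wide n m n' m']].

Lemma J1_refine m n m' n' b : J1 m n m' n' -> lt n b -> lt b n' ->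
  exists a, J1 m n a b /\ J1 a b m' n'.
Proof.
move=> [mm nn [far|[k [am an]]]] nb bn.
  have [a [h1 h2 h3 h4]] := far_between mm far.
  by exists a; split; split=> //; left.
have [i [j [e ai aj]]] := after_between lin an (lt_le nb) (lt_le bn); subst k.
have [a ai' aj'] := after_split am.
exists a; split; split=> //.
- exact: after_ltk ai nb ai'.
- by right; exists i.
- exact: after_ltk aj bn aj'.
- by right; exists j.
Qed.

Lemma J2_J1 n m n' m' : J2 n m n' m' -> J1 m n m' n'.
Proof.
move=> [nn mm h]; split=> //; case: h.
- move=> [-> -> _]; case: (EM (exists k, after k m m')) => [[k h]|h].
    by right; exists k.
  by left=> k a; apply: h; exists k.
- by move=> [k [h1 h2]]; right; exists k.
- move=> [_ h]; left; case=> [/= e|k [y my _]]; first by rewrite e in mm; case: (ltxx mm).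
  exact: (cdense_nadjl lin h my).
- by move=> [_ h _ _]; left.
Qed.

(* Inside a wide interval, a new block of [M] is answered inside a new block of
   size 5, at the same distance from its left end. *)
Lemma J2_refine n m n' m' b : J2 n m n' m' -> ~ deleted n -> ~ deleted n' ->
  lt m b -> lt b m' -> exists a, [/\ ~ deleted a, J2 n m a b & J2 a b n' m'].
Proof.
move=> [nn mm h] kn kn' mb bm; case: h.
- move=> [en en' nx]; subst m m'; exists b; split.
  + by move=> db; apply: nx db mb bm.
  + split=> //; apply: Or41; split=> // x dx nx' xb; apply: (nx x) => //.
    exact: (lt_trans lin) xb bm.
  + split=> //; apply: Or41; split=> // x dx nx' xb; apply: (nx x) => //.
    exact: (lt_trans lin) mb nx'.
- move=> [k [an am]].
  have [i [j [e ai aj]]] := after_between lin am (lt_le mb) (lt_le bm); subst k.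
  have [a ai' aj'] := after_split an; exists a; split.
  + by move/(deleted_after ai').
  + by split=> //; [exact: after_ltk ai mb ai'|apply: Or42; exists i].
  + by split=> //; [exact: after_ltk aj bm aj'|apply: Or42; exists j].
- move=> [dn dm].
  have [a [na an']] : exists r, lt n r /\ lt r n'.
    by case: dn => _; apply=> //; apply: (le_refl lin).
  exists a; split.
  + move=> [za az].
    (* A dense interval with kept ends that meets [z] would contain all of [z], hence an
       adjacency. *)
    have a01 : adj (z 0) (z 1) := pat_adj0 hz.
    have hn' : lt (z 4) n'.
      by apply: (nle_lt lin) => h; apply: kn'; split=> //; apply: (le_trans lin za (lt_le an')).
    have hn : lt n (z 0).
      by apply: (nle_lt lin) => h; apply: kn; split=> //; apply: (le_trans lin (lt_le na) az).
    apply: (cdense_nadj dn (lt_le hn) a01).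
    apply: (le_trans lin) (lt_le hn'); exact: (pat_le lin hz).
  + split=> //; apply: Or43; split.
      exact: (cdense_sub lin dn (le_refl lin n) na (lt_le an')).
    exact: (cdense_sub lin dm (le_refl lin m) mb (lt_le bm)).
  + split=> //; apply: Or43; split.
      exact: (cdense_sub lin dn (lt_le na) an' (le_refl lin n')).
    exact: (cdense_sub lin dm (lt_le mb) bm (le_refl lin m')).
move=> [[_ ni] far ma mp].
case: (EM (exists k, after k m b)) => [[k amb]|nl].
  have [a ana] := ma _ _ amb.
  have na : lt n a := after_ltk amb mb ana.
  have an' : lt a n'.
    case: (le_or_lt lin n' a) => // h; case: ni.
    have [i [j [_ ai _]]] := after_between lin ana (lt_le nn) h.
    exact: after_item ai.
  exists a; split.
  + by move/(deleted_after ana).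
  + by split=> //; apply: Or42; exists k.
  + split=> //; apply: Or44; split.
    * by split=> // /(item_after_l ana (lt_le an')).
    * by move=> j aj; apply: (far (k + j)); apply: after_cat amb aj.
    * move=> j y aj; have [y'] := ma _ _ (after_cat amb aj).
      move=> /after_split[a' ana' aj']; rewrite (after_fun lin ana ana').
      by exists y'.
    * by [].
case: (EM (exists k, after k b m')) => [[k abm]|nr].
  have [a aan] := mp _ _ abm.
  have an' : lt a n' := after_ltk abm bm aan.
  have na : lt n a.
    case: (le_or_lt lin a n) => // h; case: ni.
    have [j [i [_ _ ai]]] := after_between lin aan h (lt_le nn).
    exact: after_item ai.
  exists a; split.
  + by move/(deleted_after aan).
  + split=> //; apply: Or44; split.
    * by split=> // /(item_after_r aan (lt_le na)).
    * by move=> j aj; apply: nl; exists j.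
    * by [].
    * move=> j y aj; have [y'] := mp _ _ (after_cat aj abm).
      move=> /after_split[a' aj' ana'].
      by rewrite -(after_inj lin ana' aan); exists y'.
  + by split=> //; apply: Or42; exists k.
(* If [z] lies inside the interval, the new block is sought between [n] and [z 0]; otherwise no
   block inside the interval meets [z]. *)
have [c [hc nc cn kc]] : exists c, [/\ pat None c, lt n (c 0), lt (c 4) n' &
    forall i, i <= 4 -> ~ deleted (c i)].
  case: (EM (lt n (z 0) /\ lt (z 4) n')) => [[nz zn]|h].
    have [c [hc nc cz]] := rich_pat None (zero_rich_r hz (leq0n 4) nz).
    exists c; split=> //.
      apply: (lt_trans lin) cz _; apply: (le_lt_trans lin) zn.
      exact: (pat_le lin hz).
    move=> i i4 [zc _]; apply: (lt_nle lin cz).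
    exact: (le_trans lin) zc (pat_le lin hc i4 (leqnn _)).
  have [c [hc nc cn]] := rich_pat None (conj nn ni).
  exists c; split=> // i i4 [zc cz]; apply: h; split; apply: (nle_lt lin) => h'.
    apply: kn; split=> //; apply: (le_trans lin) _ cz; apply: lt_le.
    exact: (lt_le_trans lin) nc (pat_le lin hc (leq0n i) i4).
  apply: kn'; split=> //; apply: (le_trans lin) zc _; apply: lt_le.
  exact: (le_lt_trans lin) (pat_le lin hc i4 (leqnn _)) cn.
have [i [u [ub npu]]] := block_first b.
have [j [v [bv nsv]]] := block_last b.
(* By [th_five] the block of [b] has at most five elements, so the [i] elements before [b] and the
   [j] after it fit around [c i]. *)
have ij4 : i + j <= 4.
  rewrite leqNgt; apply/negP => h; have a := after_cat ub bv.
  rewrite (_ : i + j = 5 + (i + j - 5)) in a; last by lia.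
  by have [w /after_five] := after_split a.
have cadj p : p < 4 -> adj (c p) (c p.+1) by case: hc => _ _; apply.
exists (c i); have i4 : i <= 4 by lia.
split; first exact: kc.
- split=> //; first exact: (lt_le_trans lin) nc (pat_le lin hc (leq0n i) i4).
  apply: Or44; split=> //.
  + exact: zero_rich_r.
  + by move=> k a; apply: nl; exists k.
  + move=> k y ayb; have ki : k <= i.
      rewrite leqNgt; apply/negP => ik.
      rewrite -(subnK (ltnW ik)) in ayb; have [w yw wb] := after_split ayb.
      rewrite (after_inj lin wb ub) in yw.
      by move: (nopred_after npu yw); lia.
    exists (c (i - k)); rewrite -{2}(subnK ki); apply: seq_after => p p1 p2.
    by apply: cadj; lia.
- split=> //; first exact: (le_lt_trans lin) (pat_le lin hc i4 (leqnn _)) cn.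
  apply: Or44; split=> //.
  + exact: zero_rich_l.
  + by move=> k a; apply: nr; exists k.
  + move=> k y aby; have kj : k <= 4 - i.
      rewrite leqNgt; apply/negP => h; have a := after_cat ub aby.
      rewrite (_ : i + k = 5 + (i + k - 5)) in a; last by lia.
      by have [w /after_five] := after_split a.
    exists (c (i + k)); apply: seq_after => p p1 p2.
    by apply: cadj; lia.
Qed.
End Model.

(** * The game between a model and its remainder *)

Section Game.
Variables (M : structure) (th : theory M) (z : nat -> M) (hz : pat None z).
Let lin : linear_order M := th_lin th.
Notation N := (remainder th hz).
Let linN : linear_order N := remainder_lin th hz.
Notation point := (@point M th z hz).
Notation deleted := (deleted z).

Lemma kept_point x : ~ deleted x -> exists p : N, point p = x.
Proof. exact: point_surj. Qed.

Lemma kept_lt (p : N) : leS (point p) (z 4) -> lt (point p) (z 0).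
Proof. by move=> h; apply: (nle_lt lin) => h'; apply: (point_kept (p := p)). Qed.

Lemma kept_gt (p : N) : leS (z 0) (point p) -> lt (z 4) (point p).
Proof. by move=> h; apply: (nle_lt lin) => h'; apply: (point_kept (p := p)). Qed.

Lemma zero_lt : lt (z 0) (z 4).
Proof. exact: (pat_lt lin hz). Qed.

Lemma J1_back_forth (p q : M * N) :
  J1 p.1 (point p.2) q.1 (point q.2) -> back_forth 1 p q.
Proof.
move=> h; have [h1 h2 _] := h; split=> //; first exact/point_lt.
move=> l; apply: (@back_forth_refine M N linN
  (fun x y => J1 x.2 (point x.1) y.2 (point y.1)) (fun=> True) _ 0 [::]) => //.
- move=> p' q' b h' _ /point_lt pb /point_lt bq.
  have [a [ha1 ha2]] := J1_refine th h' pb bq.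
  by exists a.
- exact/point_lt.
- by move=> x y [h3 h4 _]; split=> //; apply/point_lt.
Qed.

Lemma J2_back_forth (p q : N * M) :
  J2 z (point p.1) p.2 (point q.1) q.2 -> back_forth 2 p q.
Proof.
move=> h; have [h1 h2 _] := h; split=> //; first exact/point_lt.
move=> l; apply: (@back_forth_refine N M lin
  (fun x y => J2 z (point x.2) x.1 (point y.2) y.1) (fun=> True) _ 1 [::]) => //.
- move=> p' q' b h' _ pb bq.
  have [a [ka ha1 ha2]] := J2_refine th hz h' (point_kept (p := _)) (point_kept (p := _)) pb bq.
  by have [a' def] := kept_point ka; exists a'; rewrite /= def.
- exact/point_lt.
- by move=> x y h'; apply: J1_back_forth; apply: J2_J1 h'.
Qed.

Definition zero_after (z' : nat -> M) := pat None z' /\ lt (z 4) (z' 0).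

Definition shifted z' n m n' m' :=
  [/\ zero_after z', n = z' 4, m = z 4, n' = m' & lt (z' 4) n'].

(** This is [J2] with [shifted] in place of [wide]. At depth 3 points of the remainder are played
    first, and [wide] asks nothing about items inside the interval of [M] that could answer them; in
    a shifted interval they are answered by themselves. *)
Definition S2 z' n m n' m' := [/\ lt n n', lt m m' &
  [\/ same z n m n' m', exists k, after k n n' /\ after k m m',
      cdense n n' /\ cdense m m' | shifted z' n m n' m']].

Lemma zero_after_lt z' i : zero_after z' -> i <= 4 -> lt (z 4) (z' i).
Proof.
move=> [h h4] i4; apply: (lt_le_trans lin) h4 _; exact: (pat_le lin h).
Qed.

Lemma zero_after_kept z' i : zero_after z' -> i <= 4 -> ~ deleted (z' i).
Proof.
by move=> h i4 [_]; apply: (lt_nle lin); apply: zero_after_lt.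
Qed.

Lemma S2_J2 z' n m n' m' : S2 z' n m n' m' -> J2 z n m n' m'.
Proof.
move=> [h1 h2 h]; split=> //; case: h; [exact: Or41|exact: Or42|exact: Or43|].
move=> [[hz' lz] en em e h3]; subst n m m'; apply: Or44.
have [_ ns _] := hz; split.
- exact: zero_rich_l.
- by move=> k a; move: h2; rewrite (nosucc_after_eq ns a) => /ltxx.
- by move=> k y a; rewrite (nosucc_after ns a); exists (z' 4).
- by move=> k y a; exists y.
Qed.

Lemma same_sub n m n' m' x : same z n m n' m' -> lt n x -> lt x n' ->
  same z n m x x /\ same z x x n' m'.
Proof.
move=> [-> -> h] nx xn; split; split=> // y dy y1 y2; apply: (h y) => //.
  exact: (lt_trans lin) y2 xn.
exact: (lt_trans lin) nx y1.
Qed.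

Lemma S2_refine z' (p q : N * M) (b : N) :
  S2 z' (point p.1) p.2 (point q.1) q.2 -> lt p.1 b -> lt b q.1 ->
  exists a, S2 z' (point p.1) p.2 (point b) a /\ S2 z' (point b) a (point q.1) q.2.
Proof.
case: p q => [n m] [n' m'] /= [h1 h2 h] /point_lt nb /point_lt bn.
case: h => [h|[k [an am]]|[hn hm]|[hz' en em e h3]].
- have [h3 h4] := same_sub h nb bn; have [e1 e2 _] := h.
  exists (point b); split; split=> //; try exact: Or41; by rewrite -?e1 -?e2.
- have [i [j [e ai aj]]] := after_between lin an (lt_le nb) (lt_le bn); subst k.
  have [a ai' aj'] := after_split am.
  exists a; split; split=> //.
  + exact: after_ltk ai nb ai'.
  + by apply: Or42; exists i.
  + exact: after_ltk aj bn aj'.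
  + by apply: Or42; exists j.
- have [a [ma am]] : exists r, lt m r /\ lt r m'.
    by case: hm => _; apply=> //; apply: (le_refl lin).
  exists a; split; split=> //; apply: Or43; split.
  + exact: (cdense_sub lin hn (le_refl lin _) nb (lt_le bn)).
  + exact: (cdense_sub lin hm (le_refl lin _) ma (lt_le am)).
  + exact: (cdense_sub lin hn (lt_le nb) bn (le_refl lin _)).
  + exact: (cdense_sub lin hm (lt_le ma) am (le_refl lin _)).
- exists (point b); rewrite en in nb.
  have zb : lt (z 4) (point b) by apply: (lt_trans lin) nb; apply: zero_after_lt.
  split; split=> //.
  + by rewrite en.
  + by rewrite em.
  + by apply: Or44; split=> //; rewrite en.
  + by rewrite -e.
  + apply: Or41; split=> // x [_ x4] bx _; apply: (lt_nle lin zb).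
    exact: (le_trans lin) (lt_le bx) x4.
Qed.

Lemma S2_list z' (p q : N * M) w (l : seq N) :
  walk (fun x y => S2 z' (point x.1) x.2 (point y.1) y.2) p w q ->
  exists w', [/\ walk (fun x y => J2 z (point x.1) x.2 (point y.1) y.2) p w' q,
    forall x, List.In x w -> List.In x w' &
    forall b, List.In b l -> lt p.1 b -> lt b q.1 -> exists a, List.In (b, a) w'].
Proof.
move=> hw.
have := @refine_list M N linN (fun x y => S2 z' (point x.1) x.2 (point y.1) y.2) (fun=> True).
case/(_ _ l w p q hw) => //.
  by move=> p' q' b h _; apply: S2_refine.
move=> w' [h1 h2 h3]; exists w'; split=> //.
by apply: walk_mono h1 => x y; apply: S2_J2.
Qed.

(* Points of the remainder lying between [z] and [z'] are answered by points
   of [M] to the left of [z], item after item: the item through the least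
   remaining point is answered by a copy of it just before [z]. *)
Lemma cluster z' (pz : N) (l : seq N) : zero_after z' -> point pz = z' 0 ->
  (forall l1 x l2, l = l1 ++ x :: l2 -> forall y, List.In y l2 -> leS x y) ->
  forall (n : N) m, lt n pz -> lt m (z 0) -> more_after (point n) m ->
  (forall e, List.In e l -> lt n e -> lt e pz ->
     lt (z 0) (point e) /\ ~ item (point n) (point e)) ->
  exists w, walk (fun x y => J2 z (point x.1) x.2 (point y.1) y.2) (n, m) w (pz, z 0) /\
    forall e, List.In e l -> lt n e -> lt e pz -> exists a, List.In (e, a) w.
Proof.
move=> hz' hpz; have [hz'1 hz'2] := hz'.
elim: l => [|e l IH] srt n m npz mz ma inv.
  exists [::]; split=> //=; split=> //; first exact/point_lt.
  apply: Or44; have [np _ _] := hz; split=> //=.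
  - by rewrite hpz; apply: zero_rich_r => //; rewrite -hpz; apply/point_lt.
  - by move=> k a; move: mz; rewrite (nopred_after_eq np a) => /ltxx.
  - by move=> k y a; rewrite (nopred_after np a); exists (point pz).
have srt' : forall l1 x l2, l = l1 ++ x :: l2 -> forall y, List.In y l2 -> leS x y.
  by move=> l1 x l2 def; apply: (srt (e :: l1) x); rewrite def.
have emin e' : List.In e' (e :: l) -> leS e e'.
  by move=> [<-|/(srt [::] e l erefl)//]; apply: (le_refl linN).
case: (EM (lt n e /\ lt e pz)) => [[ne epz]|hne]; last first.
  have [|w [h1 h2]] := IH srt' n m npz mz ma.
    by move=> e' he'; apply: inv; right.
  exists w; split=> // e' [<- h3 h4|]; [by case: hne|exact: h2].
have [ze nie] := inv e (or_introl erefl) ne epz.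
have iee : item (point e) (point e).
  case: (th_item th (point e)) => // h.
    by case: (lt_nle lin (iffLR (point_lt _ _) ne)).
  by case: (lt_nle lin (iffLR (point_lt _ _) epz)).
(* The point [s] is the last listed one in the item of [e], so the finite pattern [c] covers all
   listed points of that item, even in an infinite group. *)
have [s [[o [c [hc ce es]]] sl _ smax]] :=
  list_max lin (List.map point l) iee.
have es' : leS (point e) s.
  case: sl => [->|/List.in_map_iff[s' [<- s'l]]]; first exact: (le_refl lin).
  by apply/point_le; apply: emin; right.
have ec := le_trans lin es' es.
have nc : lt (point n) (c 0).
  by apply: (nle_lt lin) => h; apply: nie; exists o, c.
have kc i : i <= pat_size o -> ~ deleted (c i).
  move=> io [zi iz].
  have [_ e4] := zero_item lin hz hc (pat_le lin hc (leq0n i) io)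
    (pat_le lin hc io (leqnn _)) zi iz.
  by apply: (point_kept (p := e)); split; [exact: lt_le|rewrite -e4].
have cz' : lt (c (pat_size o)) (z' 0).
  apply: (nle_lt lin) => h; have ez : lt (point e) (z' 0) by rewrite -hpz; apply/point_lt.
  have [e0 _] := zero_item lin hz'1 hc (le_trans lin ce (lt_le ez)) h
    (le_refl lin _) (pat_le lin hz'1 (isT : 0 <= 4) (leqnn 4)).
  by rewrite e0 in ce; case: (lt_nle lin ez).
(* The interval from [m] to [z 0] is rich wherever [m] lies, so there is always room for one more
   copy. *)
have [d [hd md dz]] := rich_pat th o (zero_rich_r th hz (leq0n 4) mz).
have /choice[cN hcN] : forall i, exists p : N, i <= pat_size o -> point p = c i.
  move=> i; case: (boolP (i <= pat_size o)) => [/kc/kept_point[p hp]|_].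
    by exists p.
  by exists n.
pose f i := (cN i, d i).
have fw : walk (fun x y => S2 z' (point x.1) x.2 (point y.1) y.2) (f 0)
    [seq f i | i <- iota 1 (pat_size o).-1] (f (pat_size o)).
  have -> : pat_size o = (0 + (pat_size o).-1).+1 by case: (o).
  apply: walk_seq => i _ io /=.
  have io' : i < pat_size o by move: io; case: (o).
  rewrite !hcN //; last exact: ltnW.
  have [_ _ /(_ i io') sc] := hc; have [_ _ /(_ i io') sd] := hd.
  split; [exact: step_lt sc|exact: step_lt sd|]; move: sc sd; rewrite /step; case: pat_kind => sc sd.
    by apply: Or42; exists 1; split; [exists (c i.+1)|exists (d i.+1)].
  exact: Or43.
have [w1 [hw1 _ cov1]] := S2_list (e :: l) fw.
have [npc nsc _] := hc; have [npd nsd _] := hd.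
(* The recursion restarts from the last points of [c] and [d]; as the latter has no successor,
   [more_after] holds trivially. *)
have [||||w2 [hw2 cov2]] := IH srt' (cN (pat_size o)) (d (pat_size o)).
- by apply/point_lt; rewrite hcN // hpz.
- by [].
- by move=> k y a; rewrite (nosucc_after nsd a) hcN //; exists (c (pat_size o)).
- move=> e' he' ce'; rewrite hcN // => e'pz.
  have {}ce' : lt (c (pat_size o)) (point e') by move/point_lt: ce'; rewrite hcN.
  have ne' : lt n e'.
    by apply/point_lt; apply: (lt_trans lin) nc _; apply: (le_lt_trans lin) ce';
       apply: (pat_le lin hc).
  split; first by case: (inv e' (or_intror he') ne' e'pz).
  (* An item through the last point of [c] and [e'] starts at [c 0], so it also contains [e], and
     [e'] would be a later choice than [s]. *)
  move=> [o' [c' [hc' c'c e'c']]].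
  have e0 : c' 0 = c 0.
    case: (le_or_lt lin (c 0) (c' 0)) => h.
      by apply/esym; apply: (pat_start lin hc hc' h c'c).
    apply: (pat_start lin hc' hc (lt_le h)).
    apply: (le_trans lin) (pat_le lin hc (leq0n _) (leqnn _)) _.
    exact: (le_trans lin) (lt_le ce') e'c'.
  apply: (lt_nle lin ce'); apply: (le_trans lin) es.
  apply: smax; first exact: List.in_map.
  by exists o', c'; split=> //; rewrite e0.
exists (f 0 :: w1 ++ f (pat_size o) :: w2); split.
  split; last exact: walk_cat hw1 hw2.
  split=> //=; first by rewrite hcN.
  apply: Or44; split.
  - rewrite hcN //; split=> // -[o' [c' [hc' c'n cc']]].
    have e0 := pat_start lin hc' hc (le_trans lin c'n (lt_le nc)) cc'.
    by rewrite e0 in c'n; case: (lt_nle lin nc).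
  - by move=> k a; move: md; rewrite (nopred_after_eq npd a) => /ltxx.
  - by [].
  - by move=> k y a; rewrite (nopred_after npd a); exists (point (cN 0)).
move=> e' he' ne' e'pz.
have ce' : leS (cN 0) e'.
  by apply/point_le; rewrite hcN //; apply: (le_trans lin ce); apply/point_le; apply: emin.
case: (le_eqVlt ce') => [<-|{}ce']; first by exists (d 0); left.
case: (lt_total linN e' (cN (pat_size o))) => [->|h|h].
- by exists (d (pat_size o)); right; apply: List.in_or_app; right; left.
- have [a ha] := cov1 e' he' ce' h.
  by exists a; right; apply: List.in_or_app; left.
- have he'' : List.In e' l.
    case: he' => // e'e; rewrite -e'e in h; case: (lt_nle linN h).
    by apply/point_le; rewrite hcN.
  have [a ha] := cov2 e' he'' h e'pz.
  by exists a; right; apply: List.in_or_app; right; right.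
Qed.

(** Besides [same], these are the pieces created when [z] is answered by [z']: the gap on the left,
    the steps inside the two blocks and the gap on the right. *)
Definition J3 z' m n m' n' := [/\ lt m m', lt n n' &
  [\/ same z n m n' m',
      [/\ zero_after z', m = n, lt m (z 0), m' = z 0 & n' = z' 0],
      adj m m' /\ adj n n' | shifted z' n m n' m']].

Lemma J3_back_forth z' (p q : M * N) :
  J3 z' p.1 (point p.2) q.1 (point q.2) -> back_forth 3 p q.
Proof.
case: p q => [m n] [m' n'] /= [h1 h2 h]; split=> //; first exact/point_lt.
move=> l; change (seq N) in l.
suff [w [hw cov]] : exists w,
    walk (fun x y => J2 z (point x.1) x.2 (point y.1) y.2) (n, m) w (n', m') /\
    forall b, List.In b l -> lt n b -> lt b n' -> exists a, List.In (b, a) w.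
  exists w; split=> //; apply: walk_mono hw => x y; exact: J2_back_forth.
have simple : S2 z' (point n) m (point n') m' -> exists w,
    walk (fun x y => J2 z (point x.1) x.2 (point y.1) y.2) (n, m) w (n', m') /\
    forall b, List.In b l -> lt n b -> lt b n' -> exists a, List.In (b, a) w.
  by move=> hs; have [//|w [w1 w2 w3]] := @S2_list z' (n, m) (n', m') [::] l; exists w.
case: h => [h|[hz' mn mz m'z n'z]|[h3 h4]|h]; first by apply: simple; split=> //; apply: Or41.
(* Up to [s], the last listed point before [z] or else [n], answers are the points themselves; the
   listed points after [s] in this interval lie between [z] and [z'] and are left to [cluster]. *)
- have [s [[sz ns] sl ns' smax]] : exists s : N, [/\ lt (point s) (z 0) /\ leS n s,
      s = n \/ List.In s l, leS n s & forall y, List.In y l ->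
      lt (point y) (z 0) /\ leS n y -> leS y s].
    by apply: (list_max linN); split; [rewrite -mn|apply: (le_refl linN)].
  have sn' : lt s n'.
    apply/point_lt; rewrite n'z; apply: (lt_trans lin) sz _; apply: (lt_trans lin) zero_lt _.
    exact: zero_after_lt.
  have [l' [ll' srt]] := sorting linN l.
  have [|w2 [hw2 cov2]] := cluster hz' n'z srt sn' sz (fun k y a => ex_intro _ y a).
    move=> e /ll' el se en'.
    have ze : lt (z 0) (point e).
      case: (lt_total lin (z 0) (point e)) => [ze||ez] //.
        case: (point_kept (p := e)); split; rewrite -ze; first exact: (le_refl lin).
        exact: lt_le zero_lt.
      case: (lt_nle linN se); apply: smax => //; split=> //.
      exact: (le_trans linN) ns (lt_le se).
    split=> // -[o [c [hc cs ec]]].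
    have [e0 _] := zero_item lin hz hc (le_trans lin cs (lt_le sz))
      (le_trans lin (lt_le ze) ec) (le_refl lin _) (lt_le zero_lt).
    by rewrite e0 in cs; apply: (lt_nle lin sz cs).
  rewrite m'z; case: (le_eqVlt ns) => [e|{}ns].
    subst s; exists w2; split; first by rewrite mn.
    by move=> b /ll' bl nb bn; apply: cov2.
  have hs : S2 z' (point n) m (point s) (point s).
    split; rewrite ?mn; try exact/point_lt.
    apply: Or41; split=> // x [zx _] _ xs; apply: (lt_nle lin sz).
    exact: (le_trans lin) zx (lt_le xs).
  have [//|w1 [hw1 _ cov1]] := @S2_list z' (n, m) (s, point s) [::] l.
  exists (w1 ++ (s, point s) :: w2); split; first exact: walk_cat hw1 hw2.
  move=> b bl nb bn; case: (lt_total linN b s) => [->|bs|sb].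
  + by exists (point s); apply: List.in_or_app; right; left.
  + by have [a ha] := cov1 b bl nb bs; exists a; apply: List.in_or_app; left.
  + have [a ha] := cov2 b (iffLR (ll' b) bl) sb bn.
    by exists a; apply: List.in_or_app; right; right.
- by apply: simple; split=> //; apply: Or42; exists 1; split; [exists (point n')|exists m'].
- by apply: simple; split=> //; apply: Or44.
Qed.

(** New points are answered by themselves. The restriction on [b] excludes the stretch after [z] up
    to [z' 4], where the matching [z'] leaves no room for that. *)
Lemma J3_refine z' (p q : M * N) (b : M) :
  J3 z' p.1 (point p.2) q.1 (point q.2) ->
  leS b (z 4) \/ lt (z' 4) b -> lt p.1 b -> lt b q.1 ->
  exists a : N, J3 z' p.1 (point p.2) b (point a) /\ J3 z' b (point a) q.1 (point q.2).
Proof.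
case: p q => [m n] [m' n'] /= [h1 h2 h] hb mb bm.
case: h => [h|[hz' mn mz m'z n'z]|[h3 h4]|h].
- have [e1 e2 h3] := h.
  have [a def] : exists a : N, point a = b.
    by apply: kept_point => db; apply: (h3 b db); rewrite ?e1 ?e2.
  have nb : lt (point n) b by rewrite e1.
  have bn : lt b (point n') by rewrite e2.
  have [h4 h5] := same_sub h nb bn.
  by exists a; rewrite def; split; split=> //; apply: Or41.
- have bz : lt b (z 0) by rewrite -m'z.
  have [a def] : exists a : N, point a = b.
    by apply: kept_point => -[zb _]; apply: (lt_nle lin bz).
  exists a; rewrite def; split; split=> //.
  + by rewrite -mn.
  + apply: Or41; split=> // x [zx _] _ xb; apply: (lt_nle lin bz).
    exact: (le_trans lin) zx (lt_le xb).
  + rewrite n'z; apply: (lt_trans lin) bz _; apply: (lt_trans lin) zero_lt _.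
    exact: zero_after_lt.
  + exact: Or42.
- by case: h3 => _ /(_ b) [].
- have [hz' en em e h3] := h; have zb : lt (z 4) b by rewrite -em.
  have {hb} zb' : lt (z' 4) b by case: hb => // /(lt_nle lin zb).
  have [a def] : exists a : N, point a = b.
    by apply: kept_point => -[_ bz]; apply: (lt_nle lin zb).
  exists a; rewrite def; split; split=> //.
  + by rewrite en.
  + by apply: Or44; split=> //; rewrite en.
  + by rewrite e.
  + apply: Or41; split=> // x [_ xz] bx _; apply: (lt_nle lin zb).
    exact: (le_trans lin) (lt_le bx) xz.
Qed.

(** The list is known when [z] is moved, so [z'] can be taken after [z] but before every listed
    point that follows [z]; the restriction in [J3_refine] is then met. *)
Lemma J4_back_forth (p q : N * M) :
  point p.1 = p.2 -> point q.1 = q.2 -> lt p.1 q.1 -> back_forth 4 p q.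
Proof.
case: p q => [n m] [n' m'] /= en en' nn; subst m m'.
have nn' : lt (point n) (point n') by apply/point_lt.
split=> // l; change (seq M) in l.
suff [z' [w [hw Ql]]] : exists z' w,
    walk (fun x y : M * N => J3 z' x.1 (point x.2) y.1 (point y.2))
      (point n, n) w (point n', n') /\
    forall b, List.In b l -> leS b (z 4) \/ lt (z' 4) b.
  have [|w' [hw' _ cov]] := refine_list lin _ hw Ql.
    by move=> p q b; apply: J3_refine.
  exists w'; split=> //; apply: walk_mono hw' => x y; exact: J3_back_forth.
case: (EM (lt (point n) (z 0) /\ lt (z 4) (point n'))) => [[nz zn]|h]; last first.
  (* Here [z] does not meet the interval, and the dummy choice of [z] for [z'] makes the restriction
     void. *)
  exists z, [::]; split=> [|b _]; last exact: le_or_lt.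
  split=> //; apply: Or41; split=> // x [zx xz] nx xn; apply: h.
  split; [apply: kept_lt; apply: (le_trans lin (lt_le nx) xz)|].
  by apply: kept_gt; apply: (le_trans lin zx (lt_le xn)).
have [v [zv _ vn vmin]] := list_min lin l zn.
have [z' [hz' zz' zv']] := rich_pat th None (zero_rich_l th hz (leqnn 4) zv).
have za : zero_after z' by [].
have /choice[zN hzN] : forall i, exists p : N, i <= 4 -> point p = z' i.
  move=> i; case: (boolP (i <= 4)) => [/(zero_after_kept za)/kept_point[p hp]|_].
    by exists p.
  by exists n.
pose f i := (z i, zN i).
exists z', ((f 0 :: [seq f i | i <- iota 1 3]) ++ [:: f 4]); split; last first.
  move=> b bl; case: (le_or_lt lin b (z 4)) => [|zb]; [by left|right].
  exact: (lt_le_trans lin) zv' (vmin b bl zb).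
apply: walk_cat.
  split; first last.
    apply: (@walk_seq _ _ f 0 3) => i _ i3; rewrite /= !hzN //; last exact: ltnW.
    have [_ _ /(_ i i3) hi] := hz; have [_ _ /(_ i i3) hi'] := hz'.
    by split; [case: hi|case: hi'|apply: Or43].
  rewrite /= hzN //; split=> //; last exact: Or42.
  apply: (lt_trans lin) nz _; apply: (lt_trans lin) zero_lt _; exact: zero_after_lt.
have zn' := lt_le_trans lin zv' vn.
by rewrite /= hzN //; split=> //; apply: Or44.
Qed.

Definition J5 (p q : M * N) := [/\ p.1 = point p.2, q.1 = point q.2 & lt p.2 q.2].

(** The remainder is a part of [M], so each of its points has itself as an answer. *)
Lemma J5_back_forth (p q : M * N) : J5 p q -> back_forth 5 p q.
Proof.
case: p q => [m n] [m' n'] [/= -> -> nn]; split=> //; first exact/point_lt.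
move=> l; change (seq N) in l.
apply: (@back_forth_refine M N linN
  (fun x y => [/\ point x.1 = x.2, point y.1 = y.2 & lt x.1 y.1]) (fun=> True) _ 4 [::]) => //.
- by move=> p' q' b [h1 h2 h3] _ pb bq; exists (point b).
- exact/point_lt.
- by move=> x y [h1 h2 h3]; apply: J4_back_forth.
Qed.

Lemma remainder_walk (b t : N) (l : seq N) : lt b t ->
  exists w, walk (@back_forth 5 M N) (point b, b) w (point t, t) /\
    forall n, List.In n l -> lt b n -> lt n t -> List.In (point n, n) w.
Proof.
move=> bt.
have [||w [hw _ cov]] := @refine_list M N linN
  (fun x y => [/\ x.2 = point x.1, y.2 = point y.1 & lt x.1 y.1]) (fun=> True) _
  l [::] (b, point b) (t, point t) _ (fun _ _ => I).
- by move=> p' q' n [h1 h2 h3] _ pb bq; exists (point n).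
- by [].
exists [seq swap x | x <- w]; split.
  apply: (@walk_map _ _ (@swap N M) _ (b, point b) w (t, point t)).
  by apply: walk_mono hw => x y [h1 h2 h3]; apply: J5_back_forth.
move=> n nl bn nt; have [a ha] := cov n nl bn nt.
suff e : a = point n by rewrite -e; apply: (List.in_map (@swap N M) w (n, a)).
elim: w (b, point b) hw ha {cov} => //= r w IH p [[_ rp _] hw] [rna|/(IH r hw)//].
by rewrite rna in rp.
Qed.

End Game.

(** * Deleting a block changes the isomorphism type *)

Lemma words_eq w w' : size w = size w' ->
  (forall j, j < pat_size (Some w) -> pat_kind (Some w) j = pat_kind (Some w') j) -> w = w'.
Proof.
move=> sz h; apply: (@eq_from_nth _ false) => // a aw.
have := h (3 + 5 * a + 2); rewrite /= !kind_bit => /(_ _)/negb_inj; apply; lia.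
Qed.

Section Rigid.
Variables (M : structure) (th : theory M) (z : nat -> M) (hz : pat None z).
Let lin : linear_order M := th_lin th.
Notation N := (remainder th hz).
Notation point := (@point M th z hz).
Notation deleted := (deleted z).

Variable f : M -> N.
Hypothesis f_bij : bijective f.
Hypothesis f_le : forall x y, leS x y <-> leS (f x) (f y).
(** A self-embedding of [M] whose image is the complement of [z]. It has to be shown to preserve
    patterns as they are evaluated in [M], not in the remainder. *)
Let g x := point (f x).

Lemma g_kept x : ~ deleted (g x). Proof. exact: point_kept. Qed.

Lemma g_lt x y : lt x y <-> lt (g x) (g y).
Proof.
rewrite -point_lt /lt f_le; split=> -[h1 h2]; split=> // e; apply: h2; last by rewrite e.
exact: bij_inj e.
Qed.

Lemma g_mono x y : lt x y -> lt (g x) (g y). Proof. by move=> h; apply: (iffLR (g_lt x y)). Qed.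

Lemma g_refl x y : lt (g x) (g y) -> lt x y. Proof. by move=> h; apply: (iffRL (g_lt x y)). Qed.

Lemma g_surj y : ~ deleted y -> exists x, g x = y.
Proof.
move=> /(point_surj th hz)[p <-]; have [f' _ fK] := f_bij.
by exists (f' p); rewrite /g fK.
Qed.

Lemma below_zero x : ~ deleted x -> leS x (z 4) -> lt x (z 0).
Proof. by move=> h h1; apply: (nle_lt lin) => h2; apply: h. Qed.

Lemma above_zero x : ~ deleted x -> leS (z 0) x -> lt (z 4) x.
Proof. by move=> h h1; apply: (nle_lt lin) => h2; apply: h. Qed.

Lemma near_zero x : lt x (z 0) -> exists c, [/\ pat None c, lt x (c 0) & lt (c 4) (z 0)].
Proof. by move=> xz; apply: (rich_pat th None); apply: zero_rich_r. Qed.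

(** Blocks of size 5 accumulate at [z 0] from the left, so a deleted [w] can be replaced by a point
    just before [z]. *)
Lemma kept_between u w v : ~ deleted u -> lt u w -> lt w v ->
  exists w', [/\ ~ deleted w', lt u w' & lt w' v].
Proof.
move=> ku uw wv; case: (EM (deleted w)) => [[zw wz]|kw]; last by exists w.
have [c [hc uc cz]] := near_zero (below_zero ku (le_trans lin (lt_le uw) wz)).
have c0z : lt (c 0) (z 0) by apply: (lt_trans lin) cz; apply: (pat_lt lin hc).
exists (c 0); split=> //; first by move=> [h _]; apply: (lt_nle lin c0z).
exact: (lt_trans lin) c0z (le_lt_trans lin zw wv).
Qed.

Lemma g_adj x y : adj x y -> adj (g x) (g y).
Proof.
move=> [xy h]; split=> [|w [xw wy]]; first exact: g_mono.
have [w' [/g_surj[v <-] h1 h2]] := kept_between (@g_kept x) xw wy.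
by apply: (h v); split; apply: g_refl.
Qed.

Lemma g_nosucc x : nosucc x -> nosucc (g x).
Proof.
move=> ns v xv; case: (EM (deleted v)) => [[zv vz]|/g_surj[y def]].
  have [c [hc uc cz]] := near_zero (below_zero (@g_kept x) (le_trans lin (lt_le xv) vz)).
  exists (c 0); split=> //; apply: (lt_le_trans lin) zv.
  by apply: (lt_trans lin) cz; apply: (pat_lt lin hc).
move: xv; rewrite -def => /g_refl/ns[w [xw wy]].
by exists (g w); split; apply: g_mono.
Qed.

Lemma g_nopred x : nopred x -> nopred (g x).
Proof.
move=> ns v xv; case: (EM (deleted v)) => [[zv vz]|/g_surj[y def]].
  have zx := above_zero (@g_kept x) (le_trans lin zv (lt_le xv)).
  have [c [hc uc cz]] := rich_pat th None (zero_rich_l th hz (leqnn 4) zx).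
  exists (c 0); split; first exact: (le_lt_trans lin) uc.
  by apply: (lt_trans lin) cz; apply: (pat_lt lin hc).
move: xv; rewrite -def => /g_refl/ns[w [xw wy]].
by exists (g w); split; apply: g_mono.
Qed.

(** If the image interval met [z], it would contain a block of size 5 just before [z], whose
    adjacent points come from points of the dense interval. *)
Lemma g_cdense x y : cdense x y -> cdense (g x) (g y).
Proof.
move=> [xy h]; split=> [|s t xs st ty]; first exact: g_mono.
have noz u : leS (g x) u -> leS u (g y) -> ~ deleted u.
  move=> xu uy [zu uz].
  have [c [hc uc cz]] := near_zero (below_zero (@g_kept x) (le_trans lin xu uz)).
  have kc i : i <= 4 -> ~ deleted (c i).
    move=> i4 [zc _]; apply: (lt_nle lin cz); apply: (le_trans lin) zc _.
    exact: (pat_le lin hc).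
  have [a0 d0] := g_surj (kc 0 isT); have [a1 d1] := g_surj (kc 1 isT).
  have [c01 nc] := pat_adj0 hc.
  have [|||r [h1 h2]] := h a0 a1.
  - by apply: lt_le; apply: g_refl; rewrite d0.
  - by apply: g_refl; rewrite d0 d1.
  - apply: lt_le; apply: g_refl; rewrite d1; apply: (le_lt_trans lin) (pat_le lin hc (isT : 1 <= 4) (leqnn 4)) _.
    have zy := above_zero (@g_kept y) (le_trans lin zu uy).
    exact: (lt_trans lin) cz (le_lt_trans lin zu (le_lt_trans lin uz zy)).
  - by apply: (nc (g r)); rewrite -d0 -d1; split; apply: g_mono.
have [s' ds] := g_surj (noz s xs (le_trans lin (lt_le st) ty)).
have [t' dt] := g_surj (noz t (le_trans lin xs (lt_le st)) ty).
have le_g a b : leS (g a) (g b) -> leS a b by apply: (iffRL (f_le a b)).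
subst s t.
have [r [h1 h2]] := h s' t' (le_g _ _ xs) (g_refl st) (le_g _ _ ty).
by exists (g r); split; apply: g_mono.
Qed.

Lemma g_pat o c : pat o c -> pat o (fun i => g (c i)).
Proof.
move=> [np ns h]; split; [exact: g_nopred|exact: g_nosucc|].
move=> i io; move: (h i io); rewrite /step; case: pat_kind; [exact: g_adj|exact: g_cdense].
Qed.

(** Patterns are preserved, so a group and its image spell the same finite prefixes, while
    [th_group] separates different groups by such prefixes. *)
Lemma g_group c : pat (Some [::]) c -> g (c 0) = c 0.
Proof.
move=> hc; case: (lt_total lin (g (c 0)) (c 0)) => // h.
  have [w [w' [d [d' [sz ne hd hd' [e e']]]]]] := th_group th (g_pat hc) hc h.
  case: ne; apply: words_eq => // j js.
  have e0 : d 0 = g (d' 0) by rewrite e e'.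
  have ss : pat_size (Some w) <= pat_size (Some w') by rewrite /= sz.
  by have [_ k] := pat_agree lin hd (g_pat hd') e0 (leqnn _) ss; apply: k.
have [w [w' [d [d' [sz ne hd hd' [e e']]]]]] := th_group th hc (g_pat hc) h.
case: ne; apply: words_eq => // j js.
have e0 : g (d 0) = d' 0 by rewrite e e'.
have ss : pat_size (Some w) <= pat_size (Some w') by rewrite /= sz.
by have [_ k] := pat_agree lin (g_pat hd) hd' e0 (leqnn _) ss; apply: k.
Qed.

(** If [z 0] is moved, a group between it and its image is fixed, against monotonicity; if it is not
    moved, it lies in the image and is kept. *)
Lemma no_embedding_onto_remainder : False.
Proof.
case: (lt_total lin (z 0) (g (z 0))) => [e|h|h].
- apply: (@g_kept (z 0)); rewrite -e; split; first exact: (le_refl lin).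
  exact: (pat_le lin hz).
- have [d [hd zd dz]] := th_zero th hz (g_pat hz) h.
  move/g_mono: zd; rewrite (g_group hd) => zd; exact: (lt_nle lin dz (lt_le zd)).
- have [d [hd zd dz]] := th_zero th (g_pat hz) hz h.
  move/g_mono: dz; rewrite (g_group hd) => dz; exact: (lt_nle lin dz (lt_le zd)).
Qed.

End Rigid.

Lemma remainder_not_iso (M : structure) (th : theory M) z (hz : pat None z) :
  ~ isomorphic M (remainder th hz).
Proof. by move=> [f [fb fl]]; apply: no_embedding_onto_remainder fb fl. Qed.

Lemma remainder_countable (M : structure) (th : theory M) z (hz : pat None z) :
  countable_structure M -> countable_structure (remainder th hz).
Proof.
move=> [f fi]; exists (fun p => f (@point M th z hz p)) => p q /fi; exact: point_inj.
Qed.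

(** * Scott sentences of low complexity *)

Lemma avoiding_zero (M : structure) (th : theory M) (l : seq M) :
  exists z, pat None z /\ forall x, List.In x l -> ~ deleted z x.
Proof.
have lin := th_lin th.
have [b [hb _]] := th_bot th; have [t [ht [s st]]] := th_top th.
have bt : lt b t by apply: (le_lt_trans lin) st.
have [v [bv _ _ vmin]] := list_min lin l bt.
(* The least point lies in no item, so the interval from it to the first listed point [v] after it
   is rich. *)
have [z [hz bz zv]] := rich_pat th None (bottom_rich th hb bv).
exists z; split=> // x xl [zx xz].
apply: (lt_nle lin zv); apply: (le_trans lin) xz; apply: vmin => //.
exact: (lt_le_trans lin) bz zx.
Qed.

Lemma Pi5_indistinguishable (M : structure) (th : theory M) (e : nat -> M) (xs : seq nat) :
  countable_structure M ->
  exists N : structure, [/\ countable_structure N, ~ isomorphic M N & exists e' : nat -> N,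
    forall n phi, n <= 5 -> is_Pi n phi -> (forall v, free v phi -> v \in xs) ->
    sat e phi -> sat e' phi].
Proof.
move=> cM; have lin := th_lin th.
have [b [hb _]] := th_bot th; have [t [ht [s st]]] := th_top th.
have bt : lt b t by apply: (le_lt_trans lin) st.
(* The two end points are avoided along with the parameters, since the walk begins and ends
   there. *)
have [z [hz kz]] := avoiding_zero th [:: b, t & [seq e v | v <- xs]].
exists (remainder th hz); split; [exact: remainder_countable|exact: remainder_not_iso|].
have [bN dbN] := point_surj th hz (kz b (or_introl erefl)).
have [tN dtN] := point_surj th hz (kz t (or_intror (or_introl erefl))).
have /choice[e' he'] : forall v, exists p, v \in xs -> @point M th z hz p = e v.
  move=> v; case: (boolP (v \in xs)) => [/In_mem vx|_]; last by exists bN.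
  have [p hp] := point_surj th hz (kz _ (or_intror (or_intror (List.in_map e _ _ vx)))).
  by exists p.
have btN : lt bN tN by apply/point_lt; rewrite dbN dtN.
have [w [hw cov]] := remainder_walk [seq e' v | v <- xs] btN.
have bdM a : leS (@point M th z hz bN) a /\ leS a (@point M th z hz tN) by rewrite dbN dtN.
exists e' => n phi n5 hp hx.
have {}cov v : free v phi -> on_walk (@point M th z hz bN, bN) w
    (@point M th z hz tN, tN) (e v, e' v).
  move=> /hx vx; rewrite -(he' v vx).
  have [h1 h2] := bdM (@point M th z hz (e' v)).
  case: (le_eqVlt (iffRL (point_le _ _) h1)) => [<-|{}h1]; first exact: Or31.
  case: (le_eqVlt (iffRL (point_le _ _) h2)) => [->|{}h2]; first exact: Or32.
  apply: Or33; apply: cov => //; apply: List.in_map; exact/In_mem.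
have linN := remainder_lin th hz.
case: (is_Pi_mono hp n5) => [qf|hp5].
  exact: (iffLR (qf_transfer lin linN hw qf cov)).
have [//||h _] := transfer lin linN _ _ hw cov; last exact: h.
by move=> p; apply: bdM.
Qed.

Lemma sentence_models phi (N : structure) (e : nat -> N) :
  sentence phi -> sat e phi -> models N phi.
Proof. by move=> st h e'; apply: (iffLR (sat_ext _)) h => v /st. Qed.

Lemma not_scott_Pi5 (M : structure) (th : theory M) (phi : formula) (e : nat -> M) (xs : seq nat) :
  countable_structure M -> scott_sentence M phi ->
  (forall (N : structure) (e' : nat -> N),
    (forall n psi, n <= 5 -> is_Pi n psi -> (forall v, free v psi -> v \in xs) ->
      sat e psi -> sat e' psi) -> sat e' phi) -> False.
Proof.
move=> cM [st iso] H; have [N [cN niso [e' he']]] := Pi5_indistinguishable th e xs cM.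
by apply: niso; apply/iso => //; apply: sentence_models st (H N e' he').
Qed.

Lemma no_scott_sentence (M : structure) (th : theory M) c : countable_structure M ->
  has_scott_sentence_in M c ->
  match c with CSigma n => 6 < n | CPi n | CdSigma n => 5 < n end.
Proof.
move=> cM [phi [hc sc]].
have [st iso] := sc.
have hM : models M phi.
  by apply/(iso M cM); exists id; split=> //; exists id.
have [b _] := th_bot th; pose e := fun _ : nat => b.
have sigma n psi (e0 : nat -> M) : n <= 6 -> is_Sigma n psi -> sentence psi -> sat e0 psi ->
    exists (e1 : nat -> M) (xs : seq nat), forall (N : structure) (e' : nat -> N),
      (forall n phi, n <= 5 -> is_Pi n phi -> (forall v, free v phi -> v \in xs) ->
      sat e1 phi -> sat e' phi) -> sat e' psi.
  move=> n6 /is_Sigma_inv[[_ qf] st' h|[f [xs [psi' [hf hp ->]]]] st' [i /sat_FExs[c' h]]].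
    by exists e0, [::] => N e' H; apply: (H 0) => // [|v /st' //]; apply: Pi_qf.
  exists (upd (xs i) c' e0), (xs i) => N e' H; exists i; apply/sat_FExs.
  exists e'; have -> : upd (xs i) e' e' = e' by apply: funext => v; rewrite /upd if_same.
  apply: (H (f i)) => //; first by rewrite -ltnS (leq_trans (hf i)).
  move=> v fv; apply: contrapT => /negP vx; apply: (st' v); exists i.
  exact/free_FExs.
case: c hc => n /=.
- move=> hs; rewrite ltnNge; apply/negP => n6.
  have [e1 [xs H]] := sigma n phi e n6 hs st (hM e).
  by apply: (not_scott_Pi5 th (e := e1) (xs := xs) cM sc) => N e' /H.
- move=> hp; rewrite ltnNge; apply/negP => n5.
  by apply: (not_scott_Pi5 th (e := e) (xs := [::]) cM sc) => N e' H; apply: (H n) => // v /st.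
- move=> [p [q [def hp hq]]]; rewrite ltnNge; apply/negP => n5.
  have [sp sq] : sentence p /\ sentence q.
    by split=> v fv; apply: (st v); rewrite def; [left|right].
  have [hMp hMq] : sat e p /\ sat e q by have := hM e; rewrite def.
  (* Only [p] needs witnesses: [q] is a sentence and holds under every assignment. *)
  have [e1 [xs H]] := sigma n p e (leqW n5) hp sp hMp.
  apply: (not_scott_Pi5 th (e := e1) (xs := xs) cM sc) => N e' H'.
  rewrite def; split; first exact: H.
  apply: (H' n) => // [v /sq //|].
  by apply: (iffLR (sat_ext _)) hMq => v /sq.
Qed.

(** * The axioms are Pi_4 *)

(** Kept apart from [dPi K 0] and [dSigma K 0] because it is closed under all finite Boolean
    operations. *)
Definition dqf K (P : spred) : Prop := exists phi,
  [/\ finitary_qf phi, forall v, free v phi -> v < K &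
      forall (M : structure) (e : nat -> M), sat e phi <-> P M e].

Lemma dqf_Pi0 K P : dqf K P -> dPi K 0 P.
Proof. by move=> [f [h1 h2 h3]]; exists f; split=> //; apply: Pi_qf. Qed.

Lemma dqf_Sigma0 K P : dqf K P -> dSigma K 0 P.
Proof. by move=> [f [h1 h2 h3]]; exists f; split=> //; apply: Sigma_qf. Qed.

Lemma dqf_Pi K n P : 0 < n -> dqf K P -> dPi K n P.
Proof. by move=> n0 /dqf_Sigma0; apply: dPi_up. Qed.

Lemma dqf_Sigma K n P : 0 < n -> dqf K P -> dSigma K n P.
Proof. by move=> n0 /dqf_Pi0; apply: dSigma_up. Qed.

Lemma dqf_const K (A : Prop) : dqf K (fun _ _ => A).
Proof.
case: (EM A) => h; [exists FTrue|exists FFalse]; split=> // M e /=; by split.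
Qed.

Lemma dqf_le K i j : i < K -> j < K -> dqf K (fun M e => leS (e i) (e j)).
Proof. by move=> iK jK; exists (FLe i j); split=> //= v [->|->]. Qed.

Lemma dqf_eq K i j : i < K -> j < K -> dqf K (fun M e => e i = e j).
Proof. by move=> iK jK; exists (FEq i j); split=> //= v [->|->]. Qed.

Lemma dqf_and K P Q : dqf K P -> dqf K Q -> dqf K (fun M e => P M e /\ Q M e).
Proof.
move=> [f [f1 f2 f3]] [g [g1 g2 g3]]; exists (FAnd f g); split=> [|v|M e] /=.
- by rewrite f1.
- by case=> [/f2|/g2].
- by rewrite f3 g3.
Qed.

Lemma dqf_not K P : dqf K P -> dqf K (fun M e => ~ P M e).
Proof. by move=> [f [f1 f2 f3]]; exists (FNot f); split=> // M e /=; rewrite f3. Qed.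

Lemma dqf_imp K P Q : dqf K P -> dqf K Q -> dqf K (fun M e => P M e -> Q M e).
Proof.
move=> hP hQ; have [f [f1 f2 f3]] := dqf_not (dqf_and hP (dqf_not hQ)).
exists f; split=> // M e; rewrite f3; split=> [h p|h [p]]; last by apply; apply: h.
by apply: contrapT => q; apply: h.
Qed.

Lemma dqf_or K P Q : dqf K P -> dqf K Q -> dqf K (fun M e => P M e \/ Q M e).
Proof.
move=> hP hQ; have [f [f1 f2 f3]] := dqf_imp (dqf_not hP) hQ.
exists f; split=> // M e; rewrite f3; split=> [h|[//|//]].
by case: (EM (P M e)) => [|/h]; [left|right].
Qed.

Lemma dqf_lt K i j : i < K -> j < K -> dqf K (fun M e => lt (e i) (e j)).
Proof. by move=> iK jK; apply: dqf_and; [apply: dqf_le|apply: dqf_not; apply: dqf_eq]. Qed.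

Lemma dPi_mono K m n P : 0 < m -> m <= n -> dPi K m P -> dPi K n P.
Proof.
move=> m0 mn [f [h1 h2 h3]]; case: (is_Pi_mono h1 mn) => h; last by exists f.
by apply: dqf_Pi; [apply: leq_trans mn|exists f].
Qed.

Lemma sat_assign_mix (M : structure) K phi (e : nat -> M) y c :
  (forall v, free v phi -> v < K.+1) -> c K = y ->
  sat (mix K e c) phi <-> sat (assign e K y) phi.
Proof.
move=> h cK; apply: sat_ext => v /h; rewrite ltnS leq_eqVlt /mix /assign => /orP[/eqP->|vK].
  by rewrite ltnn eqxx.
by rewrite vK ltn_eqF.
Qed.

Lemma dPi_forall K m n P : m < n -> dSigma K.+1 m P ->
  dPi K n (fun M e => forall y, P M (assign e K y)).
Proof.
move=> mn hP; apply: dPi_ext (dPi_all K mn (fun _ : nat => hP)) => M e.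
have [f [_ h2 h3]] := hP; split=> [h y|h _ c].
  by have := h 0 (fun=> y); rewrite -!h3; apply: (iffLR (sat_assign_mix _ h2 erefl)).
by have := h (c K); rewrite -!h3; apply: (iffRL (sat_assign_mix _ h2 erefl)).
Qed.

Lemma dSigma_exists K m n P : m < n -> dPi K.+1 m P ->
  dSigma K n (fun M e => exists y, P M (assign e K y)).
Proof.
move=> mn hP; apply: dSigma_ext (dSigma_ex K mn (fun _ : nat => hP)) => M e.
have [f [_ h2 h3]] := hP; split=> [[_ [c]]|[y h]].
  rewrite -h3 => h; exists (c K); rewrite -h3.
  exact: (iffLR (sat_assign_mix _ h2 erefl)).
exists 0, (fun=> y); move: h; rewrite -!h3.
exact: (iffRL (sat_assign_mix _ h2 erefl)).
Qed.

Lemma assign_old (T : Type) (e : nat -> T) K y i : i < K -> assign e K y i = e i.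
Proof. by move=> iK; rewrite /assign ltn_eqF. Qed.

Lemma assign_new (T : Type) (e : nat -> T) K y : assign e K y K = y.
Proof. by rewrite /assign eqxx. Qed.

Lemma dPi_adj K i j : i < K -> j < K -> dPi K 1 (fun M e => adj (e i) (e j)).
Proof.
move=> iK jK; apply: dPi_and => //; first by apply: dqf_Pi => //; apply: dqf_lt.
have h : dSigma K.+1 0 (fun M e => ~ (lt (e i) (e K) /\ lt (e K) (e j))).
  by apply: dqf_Sigma0; apply: dqf_not; apply: dqf_and; apply: dqf_lt => //; apply: ltnW.
apply: dPi_ext (dPi_forall (isT : 0 < 1) h) => M e.
by split=> H w; move: (H w);
  rewrite (assign_old _ _ iK) (assign_old _ _ jK) !assign_new.
Qed.

Lemma dPi_nopred K i : i < K -> dPi K 2 (fun M e => nopred (e i)).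
Proof.
move=> iK; have iK1 : i < K.+1 by apply: ltnW.
(* The hypothesis of the implication goes inside the existential quantifier, which gives the Pi_2
   form directly; when it fails, any witness will do. *)
have h : dPi K.+2 0 (fun M e => lt (e K) (e i) -> lt (e K) (e K.+1) /\ lt (e K.+1) (e i)).
  apply: dqf_Pi0; apply: dqf_imp; first by apply: dqf_lt; lia.
  by apply: dqf_and; apply: dqf_lt; lia.
apply: dPi_ext (dPi_forall (isT : 1 < 2) (dSigma_exists (isT : 0 < 1) h)) => M e.
split=> [H y yi|H y].
  have [w] := H y.
  rewrite !(assign_old _ _ (ltnSn K), assign_old _ _ iK1, assign_old _ _ iK, assign_new).
  by move/(_ yi); exists w.
case: (EM (lt y (e i))) => [/H[w hw]|nyi]; [exists w|exists y];
  by rewrite !(assign_old _ _ (ltnSn K), assign_old _ _ iK1, assign_old _ _ iK, assign_new).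
Qed.

Lemma dPi_nosucc K i : i < K -> dPi K 2 (fun M e => nosucc (e i)).
Proof.
move=> iK; have iK1 : i < K.+1 by apply: ltnW.
have h : dPi K.+2 0 (fun M e => lt (e i) (e K) -> lt (e i) (e K.+1) /\ lt (e K.+1) (e K)).
  apply: dqf_Pi0; apply: dqf_imp; first by apply: dqf_lt; lia.
  by apply: dqf_and; apply: dqf_lt; lia.
apply: dPi_ext (dPi_forall (isT : 1 < 2) (dSigma_exists (isT : 0 < 1) h)) => M e.
split=> [H y yi|H y].
  have [w] := H y.
  rewrite !(assign_old _ _ (ltnSn K), assign_old _ _ iK1, assign_old _ _ iK, assign_new).
  by move/(_ yi); exists w.
case: (EM (lt (e i) y)) => [/H[w hw]|nyi]; [exists w|exists y];
  by rewrite !(assign_old _ _ (ltnSn K), assign_old _ _ iK1, assign_old _ _ iK, assign_new).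
Qed.

Lemma dPi_cdense K i j : i < K -> j < K -> dPi K 2 (fun M e => cdense (e i) (e j)).
Proof.
move=> iK jK; apply: dPi_and => //; first by apply: dqf_Pi => //; apply: dqf_lt.
have h : dPi K.+3 0 (fun M e => leS (e i) (e K) /\ lt (e K) (e K.+1) /\ leS (e K.+1) (e j) ->
    lt (e K) (e K.+2) /\ lt (e K.+2) (e K.+1)).
  apply: dqf_Pi0; apply: dqf_imp; last by apply: dqf_and; apply: dqf_lt; lia.
  apply: dqf_and; first by apply: dqf_le; lia.
  by apply: dqf_and; [apply: dqf_lt; lia|apply: dqf_le; lia].
have h1 := dSigma_exists (isT : 0 < 1) h.
have h2 : dPi K 2 (fun M e => forall c : nat -> M, exists y : M,
   leS (e i) (c K) /\ lt (c K) (c K.+1) /\ leS (c K.+1) (e j) -> lt (c K) y /\ lt y (c K.+1)).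
  apply: dPi_ext (dPi_all K (isT : 1 < 2) (fun _ : nat => h1)) => M e.
  have ev (c : nat -> M) y : [/\ assign (mix K e c) K.+2 y i = e i,
     assign (mix K e c) K.+2 y j = e j, assign (mix K e c) K.+2 y K = c K,
     assign (mix K e c) K.+2 y K.+1 = c K.+1 & assign (mix K e c) K.+2 y K.+2 = y].
    have K1 : (K.+1 < K) = false by lia.
    have iK2 : i < K.+2 by lia. have jK2 : j < K.+2 by lia.
    have K02 : K < K.+2 by lia. have K12 : K.+1 < K.+2 by lia.
    rewrite assign_new (assign_old _ _ iK2) (assign_old _ _ jK2).
    by rewrite (assign_old _ _ K02) (assign_old _ _ K12) /mix iK jK ltnn K1.
  split=> [H c|H _ c].
    by have [y hy] := H 0 c; exists y; have [e1 e2 e3 e4 e5] := ev c y;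
       rewrite e1 e2 e3 e4 e5 in hy.
  by have [y hy] := H c; exists y; have [e1 e2 e3 e4 e5] := ev c y; rewrite e1 e2 e3 e4 e5.
apply: dPi_ext h2 => M e; split=> [H s t is_ st tj|H c].
  have [y] := H (fun v => if v == K then s else t).
  rewrite eqxx (gtn_eqF (ltnSn K)) => hy; exists y; exact: hy.
case: (EM (leS (e i) (c K) /\ lt (c K) (c K.+1) /\ leS (c K.+1) (e j))) => [h'|nh].
  by have [h3 [h4 h5]] := h'; have [y hy] := H _ _ h3 h4 h5; exists y.
by exists (c K).
Qed.

Lemma dPi_pat K a o : a + pat_size o < K -> dPi K 2 (fun M e => pat o (fun i => e (a + i))).
Proof.
move=> aK.
have h : dPi K 2 (fun M e => nopred (e (a + 0)) /\ nosucc (e (a + pat_size o)) /\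
    forall i, i < pat_size o -> step (pat_kind o i) (e (a + i)) (e (a + i.+1))).
  apply: dPi_and => //; first by apply: dPi_nopred; lia.
  apply: dPi_and => //; first exact: dPi_nosucc.
  apply: (@dPi_conj K 2 (fun i M e => i < pat_size o ->
    step (pat_kind o i) (e (a + i)) (e (a + i.+1)))) => // i.
  case: (ltnP i (pat_size o)) => [io|_]; last first.
    by apply: (dPi_ext (P := fun _ _ => True)) => //; apply: dqf_Pi => //; apply: dqf_const.
  rewrite /step; case: pat_kind.
    apply: (dPi_ext (P := fun M e => adj (e (a + i)) (e (a + i.+1)))).
      by move=> M e; split=> // /(_ isT).
    by apply: (@dPi_mono _ 1) => //; apply: dPi_adj; lia.
  apply: (dPi_ext (P := fun M e => cdense (e (a + i)) (e (a + i.+1)))).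
    by move=> M e; split=> // /(_ isT).
  by apply: dPi_cdense; lia.
by apply: dPi_ext h => M e; split=> [[? []]|[]].
Qed.

Lemma pat_ext (M : structure) o (c c' : nat -> M) :
  (forall i, i <= pat_size o -> c i = c' i) -> pat o c -> pat o c'.
Proof.
move=> h [h1 h2 h3]; split; rewrite -?h // => i io.
by rewrite -!h //; [apply: h3|apply: ltnW].
Qed.

(** Numbers that code no label stand for [None]. *)
Definition nth_label (i : nat) : label := odflt None (unpickle i).

Lemma nth_labelK o : nth_label (pickle o) = o.
Proof. by rewrite /nth_label pickleK. Qed.

Lemma mix_old (T : Type) K (e c : nat -> T) i : i < K -> mix K e c i = e i.
Proof. by rewrite /mix => ->. Qed.

Lemma mix_new (T : Type) K (e c : nat -> T) i : mix K e c (K + i) = c (K + i).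
Proof. by rewrite /mix ltnNge leq_addr. Qed.

Lemma dSigma_item K a b : a < K -> b < K -> dSigma K 3 (fun M e => item (e a) (e b)).
Proof.
move=> aK bK.
have h i : dPi (K + (pat_size (nth_label i)).+1) 2 (fun M e =>
   pat (nth_label i) (fun j => e (K + j)) /\ (leS (e (K + 0)) (e a) /\
   leS (e b) (e (K + pat_size (nth_label i))))).
  apply: dPi_and => //; first by apply: dPi_pat; lia.
  by apply: dqf_Pi => //; apply: dqf_and; apply: dqf_le; lia.
apply: dSigma_ext (dSigma_ex K (isT : 2 < 3) h) => M e; split.
  move=> [i [c [hp [h1 h2]]]]; exists (nth_label i), (fun j => c (K + j)).
  rewrite !mix_new !mix_old // in h1 h2; split=> //.
  by apply: pat_ext hp => j _; rewrite mix_new.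
move=> [o [c [hp h1 h2]]]; exists (pickle o), (fun v => c (v - K)).
rewrite nth_labelK !mix_new !mix_old // !addKn; split=> //.
by apply: pat_ext hp => j _; rewrite mix_new addKn.
Qed.

Lemma dSigma_between K a b o : a < K -> b < K -> dSigma K 3 (fun M e =>
  exists c, [/\ pat o c, lt (e a) (c 0) & lt (c (pat_size o)) (e b)]).
Proof.
move=> aK bK.
have h (i : nat) : dPi (K + (pat_size o).+1) 2 (fun M e =>
   pat o (fun j => e (K + j)) /\ (lt (e a) (e (K + 0)) /\ lt (e (K + pat_size o)) (e b))).
  apply: dPi_and => //; first by apply: dPi_pat; lia.
  by apply: dqf_Pi => //; apply: dqf_and; apply: dqf_lt; lia.
apply: dSigma_ext (dSigma_ex K (isT : 2 < 3) h) => M e; split.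
  move=> [i [c [hp [h1 h2]]]]; exists (fun j => c (K + j)).
  rewrite !mix_new !mix_old // in h1 h2; split=> //.
  by apply: pat_ext hp => j _; rewrite mix_new.
move=> [c [hp h1 h2]]; exists 0, (fun v => c (v - K)).
rewrite !mix_new !mix_old // !addKn; split=> //.
by apply: pat_ext hp => j _; rewrite mix_new addKn.
Qed.

Lemma dSigma_zero K a b : a < K -> b < K -> dSigma K 3 (fun M e =>
  exists d, [/\ pat (Some [::]) d, lt (e a) (d 0) & lt (d 0) (e b)]).
Proof.
move=> aK bK.
have h (i : nat) : dPi (K + 4) 2 (fun M e =>
   pat (Some [::]) (fun j => e (K + j)) /\ (lt (e a) (e (K + 0)) /\ lt (e (K + 0)) (e b))).
  apply: dPi_and => //; first by apply: dPi_pat; rewrite /=; lia.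
  by apply: dqf_Pi => //; apply: dqf_and; apply: dqf_lt; lia.
apply: dSigma_ext (dSigma_ex K (isT : 2 < 3) h) => M e; split.
  move=> [i [c [hp [h1 h2]]]]; exists (fun j => c (K + j)).
  rewrite !mix_new !mix_old // in h1 h2; split=> //.
  by apply: pat_ext hp => j _; rewrite mix_new.
move=> [c [hp h1 h2]]; exists 0, (fun v => c (v - K)).
rewrite !mix_new !mix_old // !addKn; split=> //.
by apply: pat_ext hp => j _; rewrite mix_new addKn.
Qed.

Definition distinct_groups (M : structure) (x y : M) := exists w w' (d d' : nat -> M),
  [/\ size w = size w', w <> w', pat (Some w) d, pat (Some w') d' & d 0 = x /\ d' 0 = y].

Lemma dSigma_group K a b : a < K -> b < K ->
  dSigma K 3 (fun M e => distinct_groups (e a) (e b)).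
Proof.
move=> aK bK.
(* The pair of words is part of the index of the disjunction, so the comparison of the words becomes
   a constant. *)
pose W i : seq bool * seq bool := odflt ([::], [::]) (unpickle i).
pose s i := pat_size (Some (W i).1); pose s' i := pat_size (Some (W i).2).
have h i : dPi (K + (s i).+1 + (s' i).+1) 2 (fun M e =>
   (size (W i).1 = size (W i).2 /\ (W i).1 <> (W i).2) /\
   pat (Some (W i).1) (fun j => e (K + j)) /\
   pat (Some (W i).2) (fun j => e (K + (s i).+1 + j)) /\
   e (K + 0) = e a /\ e (K + (s i).+1 + 0) = e b).
  apply: dPi_and => //; first by apply: dqf_Pi => //; apply: dqf_const.
  apply: dPi_and => //; first by apply: dPi_pat; rewrite /s; lia.
  apply: dPi_and => //; first by apply: dPi_pat; rewrite /s'; lia.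
  by apply: dqf_Pi => //; apply: dqf_and; apply: dqf_eq; lia.
apply: dSigma_ext (dSigma_ex K (isT : 2 < 3) h) => M e; split.
  move=> [i [c [[h1 h2] [h3 [h4 [h5 h6]]]]]].
  exists (W i).1, (W i).2, (fun j => c (K + j)), (fun j => c (K + (s i).+1 + j)).
  rewrite -!addnA !mix_new !mix_old // in h5 h6.
  split=> //; last by rewrite -!addnA.
    by apply: pat_ext h3 => j _; rewrite mix_new.
  by apply: pat_ext h4 => j _; rewrite -!addnA mix_new.
move=> [w [w' [d [d' [h1 h2 h3 h4 [h5 h6]]]]]].
pose S := (pat_size (Some w)).+1.
exists (pickle (w, w')), (fun v => if v < K + S then d (v - K) else d' (v - (K + S))).
have eW : W (pickle (w, w')) = (w, w') by rewrite /W pickleK.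
rewrite /s /s' eW -/S /=; split=> //; split; last split; last split.
- apply: pat_ext h3 => j js; rewrite mix_new addKn ltn_add2l.
  by rewrite /S ltnS js.
- apply: pat_ext h4 => j js; rewrite -addnA mix_new addnA.
  by rewrite ltnNge leq_addr /= addKn.
- by rewrite mix_new mix_old // addKn ltn_add2l.
- by rewrite -addnA mix_new mix_old // addnA ltnNge leq_addr /= addKn.
Qed.

(** The two patterns in cases 8 and 9 occupy consecutive variables, 4 for the start of a group and 5
    for a block of size 5. From 10 on, the index runs through the labels in [th_rich]. *)
Definition axiom_pred (i : nat) : spred :=
  match i with
  | 0 => fun M e => leS (e 0) (e 0)
  | 1 => fun M e => leS (e 0) (e 1) -> leS (e 1) (e 0) -> e 0 = e 1
  | 2 => fun M e => leS (e 0) (e 1) -> leS (e 1) (e 2) -> leS (e 0) (e 2)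
  | 3 => fun M e => leS (e 0) (e 1) \/ leS (e 1) (e 0)
  | 4 => fun M e => exists x : M, (forall y, leS x y) /\ nosucc x
  | 5 => fun M e => exists x y : M, (forall y, leS y x) /\ lt y x
  | 6 => fun M e => ~ forall i, i < 5 -> adj (e i) (e i.+1)
  | 7 => fun M e => (forall y, leS (e 0) y) \/ ((forall y, leS y (e 0)) \/ item (e 0) (e 0))
  | 8 => fun M e => pat (Some [::]) (fun i => e (0 + i)) -> pat (Some [::]) (fun i => e (4 + i)) ->
      lt (e 0) (e 4) -> distinct_groups (e 0) (e 4)
  | 9 => fun M e => pat None (fun i => e (0 + i)) -> pat None (fun i => e (5 + i)) ->
      lt (e 0) (e 5) -> exists d, [/\ pat (Some [::]) d, lt (e 0) (d 0) & lt (d 0) (e 5)]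
  | i.+4.+4.+2 => fun M e => lt (e 0) (e 1) -> item (e 0) (e 1) \/
      exists c, [/\ pat (nth_label i) c, lt (e 0) (c 0) & lt (c (pat_size (nth_label i))) (e 1)]
  end.

Lemma axiom_pred_Sigma i : exists K, dSigma K 3 (axiom_pred i).
Proof.
case: i => [|[|[|[|[|[|[|[|[|[|i]]]]]]]]]] /=.
- by exists 1; apply: dqf_Sigma => //; apply: dqf_le.
- by exists 2; apply: dqf_Sigma => //; do 2?[apply: dqf_imp; first exact: dqf_le]; apply: dqf_eq.
- by exists 3; apply: dqf_Sigma => //; do 2?[apply: dqf_imp; first exact: dqf_le]; apply: dqf_le.
- by exists 2; apply: dqf_Sigma => //; apply: dqf_or; apply: dqf_le.
- exists 0; have h : dPi 1 2 (fun M e => (forall y, leS (e 0) y) /\ nosucc (e 0)).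
    apply: dPi_and => //; last exact: dPi_nosucc.
    exact: (dPi_forall (isT : 0 < 2) (dqf_Sigma0 (dqf_le (isT : 0 < 2) (isT : 1 < 2)))).
  exact: dSigma_exists (isT : 2 < 3) h.
- exists 0; have h : dPi 2 2 (fun M e => (forall y, leS y (e 0)) /\ lt (e 1) (e 0)).
    apply: dPi_and => //; last by apply: dqf_Pi => //; apply: dqf_lt.
    exact: (dPi_forall (isT : 0 < 2) (dqf_Sigma0 (dqf_le (isT : 2 < 3) (isT : 0 < 3)))).
  apply: dSigma_ext (dSigma_ex 0 (isT : 2 < 3) (fun _ : nat => h)) => M e; split.
    by move=> [_ [c [h1 h2]]]; exists (c 0), (c 1).
  by move=> [x [y [h1 h2]]]; exists 0, (fun v => if v == 0 then x else y).
- exists 6.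
  have h : dPi 6 2 (fun M e => forall i, i < 5 -> adj (e i) (e i.+1)).
    apply: (@dPi_conj 6 2 (fun i M e => i < 5 -> adj (e i) (e i.+1))) => // i.
    case: (ltnP i 5) => [i5|_]; last first.
      by apply: (dPi_ext (P := fun _ _ => True)) => //; apply: dqf_Pi => //; apply: dqf_const.
    apply: (dPi_ext (P := fun M e => adj (e i) (e i.+1))).
      by move=> M e; split=> // /(_ isT).
    by apply: (@dPi_mono _ 1) => //; apply: dPi_adj; lia.
  exact: dSigma_imp h (dqf_Sigma (isT : 0 < 3) (dqf_const 6 False)).
- exists 1; apply: dSigma_or => //.
    apply: (@dSigma_up 1 1 1) => //.
    exact: (dPi_forall (isT : 0 < 1) (dqf_Sigma0 (dqf_le (isT : 0 < 2) (isT : 1 < 2)))).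
  apply: dSigma_or => //; last exact: dSigma_item.
  apply: (@dSigma_up 1 1 1) => //.
  exact: (dPi_forall (isT : 0 < 1) (dqf_Sigma0 (dqf_le (isT : 1 < 2) (isT : 0 < 2)))).
- exists 8; apply: dSigma_imp; first exact: dPi_pat.
  apply: dSigma_imp; first exact: dPi_pat.
  apply: dSigma_imp; first by apply: dqf_Pi => //; apply: dqf_lt.
  exact: dSigma_group.
- exists 10; apply: dSigma_imp; first exact: dPi_pat.
  apply: dSigma_imp; first exact: dPi_pat.
  apply: dSigma_imp; first by apply: dqf_Pi => //; apply: dqf_lt.
  exact: dSigma_zero.
- exists 2; apply: dSigma_imp; first by apply: dqf_Pi => //; apply: dqf_lt.
  by apply: dSigma_or => //; [apply: dSigma_item|apply: dSigma_between].
Qed.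

Lemma axioms_theory (M : structure) :
  (forall i (e : nat -> M), axiom_pred i e) <-> theory M.
Proof.
split=> [H|[[rf an tr tt] bot top five itm rch grp zer]].
  pose e2 (x y : M) := fun v => if v == 0 then x else y.
  pose e3 (x y z : M) := fun v => if v == 0 then x else if v == 1 then y else z.
  split.
  - split=> [x|x y|x y z|x y].
    + exact: (H 0 (fun=> x)).
    + exact: (H 1 (e2 x y)).
    + exact: (H 2 (e3 x y z)).
    + exact: (H 3 (e2 x y)).
  - by case: (structure_inhabited M) => x; exact: (H 4 (fun=> x)).
  - case: (structure_inhabited M) => x; have [t [s [h1 h2]]] := H 5 (fun=> x).
    by exists t; split=> //; exists s.
  - exact: (H 6).
  - by move=> x; case: (H 7 (fun=> x)) => [|[]]; [exact: Or31|exact: Or32|exact: Or33].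
  - move=> o x y; have := H (pickle o).+4.+4.+2 (e2 x y); rewrite /= nth_labelK; exact.
  - move=> c c' hc hc' hlt; pose e v := if v < 4 then c v else c' (v - 4).
    apply: (H 8 e) => //; first by apply: pat_ext hc => i; rewrite /e /= ltnS => ->.
    by apply: pat_ext hc' => i _; rewrite /e addKn.
  - move=> c c' hc hc' hlt; pose e v := if v < 5 then c v else c' (v - 5).
    apply: (H 9 e) => //; first by apply: pat_ext hc => i; rewrite /e /= ltnS => ->.
    by apply: pat_ext hc' => i _; rewrite /e addKn.
case=> [|[|[|[|[|[|[|[|[|[|i]]]]]]]]]] e /=.
- exact: rf.
- exact: an.
- exact: tr.
- exact: tt.
- exact: bot.
- by have [t [h [s st]]] := top; exists t, s.
- exact: five.
- by case: (itm (e 0)); [left|right; left|right; right].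
- exact: grp.
- by move=> h1 h2; exact: (zer _ _ h1 h2).
- exact: rch.
Qed.

Lemma theory_Pi4 : exists phi, [/\ sentence phi, is_Pi 4 phi &
  forall M : structure, models M phi <-> theory M].
Proof.
have [phi [h1 h2 h3]] := universal_closure axiom_pred_Sigma.
by exists phi; split=> // M; rewrite h3 axioms_theory.
Qed.

(** * A countable model *)

(* A dense order without last point on the finite sequences: prefixes come
   first, and at the first difference the larger entry comes first.  The
   children [rcons s k] decrease to [s], so every interval contains all
   extensions of some nonempty sequence. *)
Fixpoint slt (s t : seq nat) : bool :=
  match s, t with
  | _, [::] => false
  | [::], _ :: _ => true
  | x :: s', y :: t' => (y < x) || (x == y) && slt s' t'
  end.

Lemma slt_irr s : slt s s = false.
Proof. by elim: s => //= x s ->; rewrite ltnn eqxx. Qed.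

Lemma slt_trans s t u : slt s t -> slt t u -> slt s u.
Proof.
elim: s t u => [|x s IH] [|y t] [|w u] //= /orP[h|/andP[/eqP<- h]] /orP[h'|/andP[/eqP<- h']].
- by rewrite (ltn_trans h').
- by rewrite h.
- by rewrite h'.
- by rewrite eqxx (IH _ _ h h') orbT.
Qed.

Lemma slt_total s t : [|| s == t, slt s t | slt t s].
Proof.
elim: s t => [|x s IH] [|y t] //=; rewrite eqseq_cons.
by case: (ltngtP x y) => //= _; rewrite ?orbT.
Qed.

Lemma slt_nil s : slt [::] s = (s != [::]).
Proof. by case: s. Qed.

Lemma slt_cat s x u : slt s (s ++ x :: u).
Proof. by elim: s => //= y s IH; rewrite eqxx IH orbT. Qed.

(** The last clause is meant for indices of items: a nonzero first entry places them before the top,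
    whose index is [[:: 0]]. *)
Lemma slt_room s t : slt s t -> exists r, [/\ r != [::],
  forall u, slt s (r ++ u), forall u, slt (r ++ u) t &
  (s == [::]) || (0 < head 0 s) -> 0 < head 0 r].
Proof.
elim: s t => [|x s IH] [|y t] //=.
  by move=> _; exists [:: y.+1]; split=> // u /=; rewrite ltnSn.
case/orP=> [yx|/andP[/eqP<- /IH[r [_ h1 h2 _]]]].
  exists ((x :: s) ++ [:: 0]); split=> // u /=; last by rewrite yx.
  by rewrite eqxx -catA slt_cat orbT.
by exists (x :: r); split=> // u /=; rewrite eqxx ?h1 ?h2 orbT.
Qed.

(* The points of the item [c] are the [(c, i, [::])], followed when the kind at
   [i] is dense by all the [(c, i, r)].  The label of [c] is coded by its last
   entry; [::] and [:: 0] are the end points.  The bits of a group are those of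
   its label, then eventually determine [c]. *)
Definition end_item (c : seq nat) : bool := (c == [::]) || (c == [:: 0]).

Definition item_label (c : seq nat) : label := nth_label (last 0 c).

(** The function [logn 2] takes each value at arbitrarily large arguments, so different groups
    differ beyond any prefixes imposed by their labels. *)
Definition item_bits (c : seq nat) (n : nat) : bool :=
  if item_label c is Some w then
    if n < size w then nth false w n else logn 2 n == pickle c
  else false.

Definition valid (x : seq nat * nat * seq nat) : bool :=
  let: (c, i, r) := x in
  if end_item c then (i == 0) && (r == [::])
  else (0 < head 0 c) &&
    (if item_label c is Some _ then (r == [::]) || ~~ kind (item_bits c) i
     else (i <= 4) && (r == [::])).

Definition tlt (x y : seq nat * nat * seq nat) : bool :=
  let: (c, i, r) := x in let: (c', i', r') := y in
  slt c c' || (c == c') && ((i < i') || (i == i') && slt r r').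

Definition carrierL : Type := {x : seq nat * nat * seq nat | valid x}.

Definition bottomL : carrierL := exist _ ([::], 0, [::]) isT.
Definition topL : carrierL := exist _ ([:: 0], 0, [::]) isT.

Definition leL (x y : carrierL) : Prop := (val x == val y) || tlt (val x) (val y).

Definition L : structure := Structure leL (inhabits bottomL).

Lemma tlt_irr x : tlt x x = false.
Proof. by case: x => -[c i] r /=; rewrite !slt_irr eqxx ltnn eqxx. Qed.

Lemma tlt_trans x y t : tlt x y -> tlt y t -> tlt x t.
Proof.
case: x y t => [[c i] r] [[c' i'] r'] [[c'' i''] r''] /=.
case/orP=> [h|/andP[/eqP<- h]] /orP[h'|/andP[/eqP<- h']].
- by rewrite (slt_trans h h').
- by rewrite h.
- by rewrite h'.
rewrite eqxx /=; apply/orP; right; case/orP: h => [h|/andP[/eqP e h]];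
  case/orP: h' => [h'|/andP[/eqP e' h']]; subst.
- by rewrite (ltn_trans h).
- by rewrite h.
- by rewrite h'.
- by rewrite eqxx (slt_trans h h') orbT.
Qed.

Lemma tlt_total x y : [|| x == y, tlt x y | tlt y x].
Proof.
case: x y => [[c i] r] [[c' i'] r'] /=; rewrite !xpair_eqE.
have := slt_total c c'; case: (eqVneq c c') => [<- _|ne] /=.
  rewrite !slt_irr ?eqxx /=; case: (ltngtP i i') => //= _; exact: slt_total.
by rewrite !orbF.
Qed.

Lemma ltL (x y : L) : lt x y <-> tlt (val (x : carrierL)) (val (y : carrierL)).
Proof.
split=> [[/orP[/eqP/val_inj->|//]]|h]; first by case.
split; first by apply/orP; right.
by move=> e; rewrite e tlt_irr in h.
Qed.

Lemma linL : linear_order L.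
Proof.
split=> [x|x y|x y t|x y]; rewrite /= /leL.
- by rewrite eqxx.
- case/orP=> [/eqP/val_inj//|h] /orP[/eqP/val_inj//|h'].
  by have := tlt_trans h h'; rewrite tlt_irr.
- case/orP=> [/eqP->//|h] /orP[/eqP<-|h']; rewrite ?h ?orbT //.
  by rewrite (tlt_trans h h') orbT.
- have := tlt_total (val x) (val y); case/or3P=> ->; [by left|left|right]; exact: orbT.
Qed.

Lemma countableL : countable_structure L.
Proof.
by exists (fun x : carrierL => pickle (val x)) => x y /(pcan_inj pickleK)/val_inj.
Qed.

Definition pt (c : seq nat) (i : nat) (r : seq nat) : L := insubd bottomL (c, i, r).

Lemma val_pt c i r : valid (c, i, r) -> val (pt c i r : carrierL) = (c, i, r).
Proof. by move=> h; rewrite /pt insubdK. Qed.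

Lemma pt_val (x : L) c i r : val (x : carrierL) = (c, i, r) -> x = pt c i r.
Proof.
by move=> e; apply: val_inj; rewrite val_pt //; have := valP (x : carrierL); rewrite e.
Qed.

Lemma point_between (x y : L) (p : seq nat * nat * seq nat) : valid p ->
  tlt (val (x : carrierL)) p -> tlt p (val (y : carrierL)) ->
  exists w : L, [/\ val (w : carrierL) = p, lt x w & lt w y].
Proof.
case: p => [[c i] r] hv h1 h2; exists (pt c i r).
by split; [|apply/ltL|apply/ltL]; rewrite val_pt.
Qed.

Definition inner (c : seq nat) := ~~ end_item c && (0 < head 0 c).

Lemma valid_none c i : inner c -> item_label c = None -> i <= 4 -> valid (c, i, [::]).
Proof. by case/andP=> /negbTE h1 h2 h3 i4; rewrite /= h1 h2 h3 i4. Qed.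

Lemma valid_some c i w : inner c -> item_label c = Some w -> valid (c, i, [::]).
Proof. by case/andP=> /negbTE h1 h2 h3; rewrite /= h1 h2 h3. Qed.

Lemma valid_gap c i w r : inner c -> item_label c = Some w -> ~~ kind (item_bits c) i ->
  valid (c, i, r).
Proof. by case/andP=> /negbTE h1 h2 h3 k; rewrite /= h1 h2 h3 k orbT. Qed.

Lemma valid_inv c i r : valid (c, i, r) ->
  [\/ end_item c /\ i = 0 /\ r = [::],
      [/\ inner c, item_label c = None, i <= 4 & r = [::]] |
      inner c /\ exists w, item_label c = Some w /\ (r != [::] -> ~~ kind (item_bits c) i)].
Proof.
rewrite /inner /=; case: (end_item c) => /=.
  by move=> /andP[/eqP-> /eqP->]; apply: Or31.
case: (0 < head 0 c) => //=; case: (item_label c) => [w h|/andP[h /eqP->]]; last exact: Or32.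
by apply: Or33; split=> //; exists w; split=> // /negbTE h'; rewrite h' in h.
Qed.

Lemma slt_end c c' : valid (c, 0, [::]) -> valid (c', 0, [::]) -> slt c c' ->
  (c == [::]) || (0 < head 0 c).
Proof.
case/valid_inv=> [[/orP[->//|/eqP->] _]|[/andP[_ ->] _ _ _]|[/andP[_ ->] _]]; rewrite ?orbT //.
case/valid_inv=> [[/orP[/eqP->|/eqP->] _]|[/andP[_ h] _ _ _]|[/andP[_ h] _]] //;
  by case: c' h => [|[|y] t].
Qed.

Lemma valid0 c i r : valid (c, i, r) -> valid (c, 0, [::]).
Proof.
case/valid_inv=> [[h _]|[h1 h2 _ _]|[h1 [w [h2 _]]]].
- by rewrite /= h.
- exact: valid_none.
- exact: valid_some h2.
Qed.

(** All extensions of some nonempty [s] lie in the interval. Appending the code of [o] gives the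
    right label and at least two entries, so the index is not that of an end point. *)
Lemma item_between o c i r c' i' r' : valid (c, i, r) -> valid (c', i', r') -> slt c c' ->
  exists q, [/\ inner q, item_label q = o, slt c q & slt q c'].
Proof.
move=> /valid0 v /valid0 v' cc; have [s [s0 h1 h2 h3]] := slt_room cc.
have s_head := h3 (slt_end v v' cc).
exists (s ++ [:: pickle o]); split=> //; last by rewrite /item_label last_cat /= nth_labelK.
by case: s s0 s_head {h1 h2 h3} => // -[|x] s.
Qed.

Lemma gap_between (x y : L) c c' i i' r r' : val (x : carrierL) = (c, i, r) ->
  val (y : carrierL) = (c', i', r') -> slt c c' -> exists w : L, lt x w /\ lt w y.
Proof.
move=> ex ey cc; have vx := valP (x : carrierL); have vy := valP (y : carrierL).
rewrite ex in vx; rewrite ey in vy.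
have [q [h1 h2 h3 h4]] := item_between None vx vy cc.
have [||w [_ w1 w2]] := @point_between x y (q, 0, [::]) (valid_none h1 h2 (leq0n 4)).
- by rewrite ex /= h3.
- by rewrite ey /= h4.
by exists w.
Qed.

(** Between different items there is another one, and each gap is a dense order without last point,
    so an adjacency can only join consecutive places of one item. *)
Lemma adjL (x y : L) : adj x y -> exists c i, [/\ inner c,
  val (x : carrierL) = (c, i, [::]), val (y : carrierL) = (c, i.+1, [::]) &
  (item_label c = None /\ i < 4) \/
  (exists w, item_label c = Some w) /\ kind (item_bits c) i].
Proof.
move=> [/ltL xy no].
have {}no p : valid p -> tlt (val (x : carrierL)) p -> tlt p (val (y : carrierL)) -> False.
  by move=> v h1 h2; have [w [_ h3 h4]] := point_between v h1 h2; apply: (no w).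
have vx := valP (x : carrierL); have vy := valP (y : carrierL).
move: xy no vx vy; case ex: (val (x : carrierL)) => [[c i] r].
case ey: (val (y : carrierL)) => [[c' i'] r'] xy no vx vy.
move: xy => /=/orP[cc|/andP[/eqP ecc h]].
  have [w [/ltL h1 /ltL h2]] := gap_between ex ey cc.
  by case: (no _ (valP (w : carrierL))); rewrite -?ex -?ey.
subst c'; case/orP: h => [ii|/andP[/eqP eii rr]]; last first.
  subst i'; have [s [s0 h1 h2 _]] := slt_room rr.
  have {}h1 := h1 [::]; have {}h2 := h2 [::]; rewrite !cats0 in h1 h2.
  case: (no (c, i, s)); try by rewrite /= slt_irr eqxx ltnn eqxx ?h1 ?h2.
  case/valid_inv: vy => [[_ [_ r0]]|[_ _ _ r0]|[ic [w [lw k]]]].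
  - by move: rr; rewrite r0; case: (r).
  - by move: rr; rewrite r0; case: (r).
  - by apply: (valid_gap _ ic lw); apply: k; move: rr; case: (r) (r') => [|? ?] [].
have mid j s : valid (c, j, s) -> (i < j) || (i == j) && slt r s ->
    (j < i') || (j == i') && slt s r' -> False.
  by move=> v h1 h2; apply: (no (c, j, s) v); rewrite /= eqxx ?h1 ?h2 orbT.
case/valid_inv: vx => [[ec [i0 r0]]|[ic ln i4 r0]|[ic [w [lw k]]]].
- case/valid_inv: vy => [[_ [i0' _]]|[/andP[/negbTE]]|[/andP[/negbTE]]].
  + by rewrite i0' in ii.
  + by rewrite ec.
  + by rewrite ec.
- case/valid_inv: vy => [[ec _]|[_ _ i4' r0']|[_ [w []]]].
  + by case/andP: ic => /negbTE; rewrite ec.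
  + have ei : i' = i.+1.
      apply/eqP; rewrite eqn_leq ii andbT leqNgt; apply/negP => h.
      apply: (mid i.+1 [::]); rewrite ?ltnSn ?h //.
      by apply: valid_none => //; lia.
    by exists c, i; rewrite r0 -ei r0'; split=> //; left; split=> //; lia.
  + by rewrite ln.
- have ki : kind (item_bits c) i.
    apply/negPn/negP => nk; apply: (mid i (r ++ [:: 0])).
    + exact: valid_gap lw nk.
    + by rewrite eqxx slt_cat orbT.
    + by rewrite ii.
  have r0 : r = [::] by apply/eqP; apply/negPn/negP => /k; rewrite ki.
  have ei : i' = i.+1.
    apply/eqP; rewrite eqn_leq ii andbT leqNgt; apply/negP => h.
    apply: (mid i.+1 [::]); rewrite ?ltnSn ?h //.
    exact: valid_some lw.
  have r0' : r' = [::].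
    apply/eqP/negPn/negP => r0'; apply: (mid i.+1 [::]); first exact: valid_some lw.
      by rewrite ltnSn.
    by rewrite ei eqxx slt_nil r0' orbT.
  by exists c, i; rewrite r0 ei r0'; split=> //; right; split=> //; exists w.
Qed.

Lemma tltL c i r c' i' r' : valid (c, i, r) -> valid (c', i', r') ->
  lt (pt c i r) (pt c' i' r') <-> tlt (c, i, r) (c', i', r').
Proof. by move=> v v'; rewrite ltL !val_pt. Qed.

Lemma tlt_same c i r i' r' :
  tlt (c, i, r) (c, i', r') = (i < i') || (i == i') && slt r r'.
Proof. by rewrite /= slt_irr eqxx. Qed.

Lemma adj_pt c i : valid (c, i, [::]) -> valid (c, i.+1, [::]) -> inner c ->
  (item_label c = None \/ kind (item_bits c) i) -> adj (pt c i [::]) (pt c i.+1 [::]).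
Proof.
move=> v v' ic hk; split; first by apply/tltL; rewrite ?tlt_same ?ltnSn.
move=> w [/ltL]; rewrite val_pt // => h1 /ltL; rewrite val_pt //.
have := valP (w : carrierL); case: (val (w : carrierL)) h1 => [[q j] s] h1 vw h2.
have eq : q = c.
  move: h1 h2 => /=/orP[h1|/andP[/eqP->//]] /orP[h2|/andP[/eqP->//]].
  by have := slt_trans h1 h2; rewrite slt_irr.
subst q; move: h1 h2; rewrite !tlt_same.
case/orP=> [ij|/andP[/eqP ej s0]] /orP[ji|/andP[/eqP ei]]; try lia.
- by case: (s).
- subst j; case/valid_inv: vw => [[ec _]|[_ ln _ es]|[_ [w' [lw k]]]].
  + by case/andP: ic => /negbTE; rewrite ec.
  + by move: s0; rewrite es.
  + case: hk => [|ki]; first by rewrite lw.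
    by rewrite slt_nil in s0; move: (k s0); rewrite ki.
Qed.

Lemma gap_room c i w r (y : L) : inner c -> item_label c = Some w ->
  ~~ kind (item_bits c) i -> lt (pt c i r) y ->
  exists s, lt (pt c i r) (pt c i s) /\ lt (pt c i s) y.
Proof.
move=> ic lw k; have v s : valid (c, i, s) := valid_gap s ic lw k.
move=> /ltL; rewrite val_pt //; case ey: (val (y : carrierL)) => [[c' i'] r'] /=.
case/orP=> [cc|/andP[/eqP ec h]].
  exists (r ++ [:: 0]); rewrite !ltL !val_pt // ey tlt_same eqxx slt_cat orbT.
  by split=> //=; rewrite cc.
subst c'; case/orP: h => [ii|/andP[/eqP ei rr]].
  exists (r ++ [:: 0]); rewrite !ltL !val_pt // ey !tlt_same eqxx slt_cat orbT.
  by split=> //=; rewrite ii.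
subst i'; have [s [_ h1 h2 _]] := slt_room rr; exists s.
rewrite !ltL !val_pt // ey !tlt_same !eqxx !ltnn /=.
by have := h1 [::]; have := h2 [::]; rewrite cats0.
Qed.

Lemma cdense_pt c i w : inner c -> item_label c = Some w -> ~~ kind (item_bits c) i ->
  cdense (pt c i [::]) (pt c i.+1 [::]).
Proof.
move=> ic lw k; have v s : valid (c, i, s) := valid_gap s ic lw k.
have v' : valid (c, i.+1, [::]) := valid_some _ ic lw.
split; first by apply/tltL; rewrite ?tlt_same ?ltnSn.
move=> s t is_ st ti.
have si := lt_le_trans linL st ti.
have [r es] : exists r, s = pt c i r.
  move: is_ si => /(le_eqVlt)[<- _|/ltL]; first by exists [::].
  rewrite val_pt // => h1 /ltL; rewrite val_pt //.
  case es: (val (s : carrierL)) h1 => [[q j] u] h1 h2.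
  have eq : q = c.
    move: h1 h2 => /=/orP[h1|/andP[/eqP->//]] /orP[h2|/andP[/eqP->//]].
    by have := slt_trans h1 h2; rewrite slt_irr.
  subst q; move: h1 h2; rewrite !tlt_same.
  case/orP=> [ij|/andP[/eqP ej s0]] /orP[ji|/andP[/eqP ei]]; try lia.
  - by case: u {es}.
  - by subst j; exists u; apply: pt_val.
rewrite es in st *; have [u [h1 h2]] := gap_room ic lw k st.
by exists (pt c i u).
Qed.

Lemma nopred_pt c : valid (c, 0, [::]) -> nopred (pt c 0 [::]).
Proof.
move=> v y /ltL; rewrite val_pt //; case ey: (val (y : carrierL)) => [[q j] u] /=.
case/orP=> [qc|/andP[_]]; first exact: gap_between ey (val_pt v) qc.
by case/andP=> _; case: u {ey}.
Qed.

Lemma nosucc_gap c i w : inner c -> item_label c = Some w -> ~~ kind (item_bits c) i ->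
  nosucc (pt c i [::]).
Proof. by move=> ic lw k y /(gap_room ic lw k)[s hs]; exists (pt c i s). Qed.

Lemma nosucc_zero c : inner c -> item_label c = None -> nosucc (pt c 4 [::]).
Proof.
move=> ic ln y; have v : valid (c, 4, [::]) by apply: valid_none.
move=> /ltL; rewrite val_pt //; case ey: (val (y : carrierL)) => [[q j] u] /=.
case/orP=> [qc|/andP[/eqP eq]]; first exact: gap_between (val_pt v) ey qc.
have := valP (y : carrierL); rewrite ey -eq.
case/valid_inv=> [[ec _]|[_ _ i4 ->]|[_ [w []]]]; last by rewrite ln.
  by case/andP: ic => /negbTE; rewrite ec.
by rewrite andbF orbF; lia.
Qed.

Lemma pat_zero c : inner c -> item_label c = None -> pat None (fun i => pt c i [::]).
Proof.
move=> ic ln; split=> [| |i i4].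
- by apply: nopred_pt; apply: valid_none.
- exact: nosucc_zero.
- by apply: adj_pt; [apply: valid_none => //; apply: ltnW|apply: valid_none| |left].
Qed.

Lemma kind_end p n : kind p (3 + 5 * n) = false.
Proof.
rewrite /kind addKn mulnC mulnK // modnMl.
have -> : (3 + n * 5 < 3) = false by lia.
by case: (p n).
Qed.

Lemma kind_mkseq p n i : i < 3 + 5 * n -> kind (nth false (mkseq p n)) i = kind p i.
Proof.
move=> h; rewrite /kind; case: (ltnP i 3) => //= i3.
by rewrite nth_mkseq // ltn_divLR //; lia.
Qed.

Lemma pat_group c w n : inner c -> item_label c = Some w ->
  pat (Some (mkseq (item_bits c) n)) (fun i => pt c i [::]).
Proof.
move=> ic lw; have v i : valid (c, i, [::]) := valid_some i ic lw.
split; rewrite ?[pat_size _]/= ?size_mkseq.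
- exact: nopred_pt.
- by apply: (nosucc_gap ic lw); rewrite kind_end.
move=> i i5; rewrite /pat_kind kind_mkseq // /step; case k: kind.
  by apply: adj_pt => //; right.
by apply: (cdense_pt ic lw); rewrite k.
Qed.

Lemma pat_label c o : inner c -> item_label c = o -> pat o (fun i => pt c i [::]).
Proof.
case: o => [w|] ic lc; last exact: pat_zero.
have -> : w = mkseq (item_bits c) (size w); last exact: pat_group lc.
apply: (@eq_from_nth _ false); first by rewrite size_mkseq.
by move=> i iw; rewrite nth_mkseq // /item_bits lc iw.
Qed.

Lemma valid_item c o i : inner c -> item_label c = o -> i <= pat_size o -> valid (c, i, [::]).
Proof. by case: o => [w|] ic lc io; [apply: valid_some lc|apply: valid_none]. Qed.

Lemma same_item (x y : L) c i i' r r' : inner c -> val (x : carrierL) = (c, i, r) ->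
  val (y : carrierL) = (c, i', r') -> item x y.
Proof.
move=> ic ex ey; have vx := valP (x : carrierL); have vy := valP (y : carrierL).
rewrite ex in vx; rewrite ey in vy.
have ne : end_item c = false by case/andP: ic => /negbTE.
case/valid_inv: vy => [[]|[_ ln i4 r0]|[_ [w [lw k]]]]; first by rewrite ne.
  case/valid_inv: vx => [[]|[_ _ i4' r0']|[_ [w []]]]; [by rewrite ne| |by rewrite ln].
  exists None, (fun i => pt c i [::]); split; first exact: pat_zero.
    rewrite /= /leL val_pt ?ex; last exact: valid_none.
    by rewrite r0' tlt_same slt_irr andbF orbF; case: i {ex i4'} => [|i]; rewrite ?eqxx ?orbT.
  rewrite /= /leL val_pt ?ey; last exact: valid_none.
  rewrite r0 tlt_same slt_irr andbF orbF; case: (ltngtP i' 4) i4 => // [|->]; rewrite ?orbT ?eqxx //.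
have v j : valid (c, j, [::]) := valid_some j ic lw.
exists (Some (mkseq (item_bits c) i'.+1)), (fun i => pt c i [::]); split; first exact: pat_group lw.
  rewrite /= /leL val_pt // ex tlt_same slt_nil.
  by case: i {ex vx} => [|i]; rewrite ?orbT //; case: r => [|? ?]; rewrite ?eqxx ?orbT.
rewrite /= /leL val_pt // ey tlt_same size_map size_iota; apply/orP; right; apply/orP; left; lia.
Qed.

(** Three adjacencies in a row also occur in a block of size 5, but there one end of the pattern
    would have a neighbour; in a group they occur only at the start. *)
Lemma pat_start_group (c : nat -> L) : pat (Some [::]) c -> exists q w,
  [/\ inner q, item_label q = Some w & c 0 = pt q 0 [::]].
Proof.
move=> [np ns h].
have [q [i [iq e0 e1 h0]]] := adjL (h 0 isT).
have [q1 [i1 [_ e1' e2 h1]]] := adjL (h 1 isT).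
have [q2 [i2 [_ e2' e3 h2]]] := adjL (h 2 isT).
rewrite e1 in e1'; case: e1' => eq1 ei1; subst q1 i1.
rewrite e2 in e2'; case: e2' => eq2 ei2; subst q2 i2.
case: h0 => [[ln i4]|[[w lw] k0]].
  case: h2 => [[_ i4']|[[w]]]; last by rewrite ln.
  have v j : j <= 4 -> valid (q, j, [::]) by apply: valid_none.
  case: i i4 i4' e0 e3 {e1 e2 h1} => [|i] i4 i4' e0 e3.
    case: (nosucc_adj ns (y := pt q 4 [::])); rewrite /= (pt_val e3).
    by apply: adj_pt => //; [apply: v|apply: v|left].
  case: (nopred_adj np (x := pt q i [::])); rewrite (pt_val e0).
  by apply: adj_pt => //; [apply: v; lia|apply: v; lia|left].
case: h1 => [[]|[_ k1]]; first by rewrite lw.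
case: h2 => [[]|[_ k2]]; first by rewrite lw.
exists q, w; split=> //; rewrite (pt_val e0).
by case: i k0 k1 k2 {e0 e1 e2 e3} => // i k0 k1 k2; case: (kind_aaa (ltn0Sn i) k0 k1 k2).
Qed.

(** A group never has four adjacencies in a row, and in a block of size 5 they fill it. *)
Lemma pat_start_zero (c : nat -> L) : pat None c -> exists q,
  [/\ inner q, item_label q = None & c 0 = pt q 0 [::]].
Proof.
move=> [np ns h].
have [q [i [iq e0 e1 h0]]] := adjL (h 0 isT).
have [q1 [i1 [_ e1' e2 h1]]] := adjL (h 1 isT).
have [q2 [i2 [_ e2' e3 h2]]] := adjL (h 2 isT).
have [q3 [i3 [_ e3' e4 h3]]] := adjL (h 3 isT).
rewrite e1 in e1'; case: e1' => eq1 ei1; subst q1 i1.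
rewrite e2 in e2'; case: e2' => eq2 ei2; subst q2 i2.
rewrite e3 in e3'; case: e3' => eq3 ei3; subst q3 i3.
case: h3 => [[ln i4]|[[w lw] k3]].
  by exists q; split=> //; rewrite (pt_val e0); congr pt; lia.
case: h1 => [[]|[_ k1]]; first by rewrite lw.
case: h2 => [[]|[_ k2]]; first by rewrite lw.
by case: (kind_aaa (ltn0Sn i) k1 k2 k3).
Qed.

Lemma fiveL (c : nat -> L) : ~ forall i, i < 5 -> adj (c i) (c i.+1).
Proof.
move=> h.
have [q [i [iq e0 e1 h0]]] := adjL (h 0 isT).
have [q1 [i1 [_ e1' e2 h1]]] := adjL (h 1 isT).
have [q2 [i2 [_ e2' e3 h2]]] := adjL (h 2 isT).
have [q3 [i3 [_ e3' e4 h3]]] := adjL (h 3 isT).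
have [q4 [i4 [_ e4' e5 h4]]] := adjL (h 4 isT).
rewrite e1 in e1'; case: e1' => eq1 ei1; subst q1 i1.
rewrite e2 in e2'; case: e2' => eq2 ei2; subst q2 i2.
rewrite e3 in e3'; case: e3' => eq3 ei3; subst q3 i3.
rewrite e4 in e4'; case: e4' => eq4 ei4; subst q4 i4.
case: h4 => [[ln]|[[w lw] _]]; first lia.
case: h1 => [[]|[_ k1]]; first by rewrite lw.
case: h2 => [[]|[_ k2]]; first by rewrite lw.
case: h3 => [[]|[_ k3]]; first by rewrite lw.
exact: (kind_aaa (ltn0Sn i) k1 k2 k3).
Qed.

Lemma bottomL_le (y : L) : leS (bottomL : L) y.
Proof.
rewrite /= /leL; case ey: (val (y : carrierL)) => [[c i] r] /=.
case: (eqVneq c [::]) => [ec|]; last by case: c {ey} => //= *; rewrite orbT.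
have := valP (y : carrierL); rewrite ey ec.
by case/valid_inv=> [[_ [-> ->]]|[]|[]].
Qed.

Lemma topL_le (y : L) : leS y (topL : L).
Proof.
rewrite /= /leL; case ey: (val (y : carrierL)) => [[c i] r].
have := valP (y : carrierL); rewrite ey.
case/valid_inv=> [[/orP[/eqP->|/eqP->] [-> ->]]|[/andP[_ h] _ _ _]|[/andP[_ h] _]] //;
  by case: c h {ey} => [|x c] //= ->; rewrite orbT.
Qed.

Lemma item_bits_neq q q' w w' : item_label q = Some w -> item_label q' = Some w' -> q != q' ->
  exists n, item_bits q n != item_bits q' n.
Proof.
(* As [k] is odd and exceeds both word lengths, [n] lies beyond both labels and [logn 2 n] is
   exactly [pickle q]. *)
move=> lw lw' qq; pose k := (size w + size w').*2.+1; pose n := 2 ^ pickle q * k.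
have kn : k <= n by rewrite leq_pmull // expn_gt0.
exists n; rewrite /item_bits lw lw'.
rewrite !ltnNge !(leq_trans _ kn) /=; try by rewrite /k; lia.
have -> : logn 2 n = pickle q.
  rewrite /n lognM // ?expn_gt0 // pfactorK // lognE /= dvdn2 /k /= odd_double /=.
  by rewrite addn0.
rewrite eqxx; apply/negP => /eqP/esym/eqP/(pcan_inj pickleK)/eqP.
by rewrite (negbTE qq).
Qed.

Lemma theoryL : theory L.
Proof.
split.
- exact: linL.
- exists bottomL; split; first exact: bottomL_le.
  move=> y /ltL /=; case ey: (val (y : carrierL)) => [[c i] r].
  case/orP=> [cc|/andP[/eqP ec]].
    exact: (@gap_between bottomL y [::] c 0 i [::] r erefl ey cc).
  have := valP (y : carrierL); rewrite ey -ec.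
  by case/valid_inv=> [[_ [-> ->]]|[]|[]].
- exists topL; split; first exact: topL_le.
  by exists bottomL; apply/ltL.
- exact: fiveL.
- move=> x; case ex: (val (x : carrierL)) => [[c i] r].
  have := valP (x : carrierL); rewrite ex.
  case/valid_inv=> [[/orP[/eqP ec|/eqP ec] [e1 e2]]|[ic _ _ _]|[ic _]].
  + apply: Or31 => y; suff -> : x = bottomL by apply: bottomL_le.
    by apply: val_inj; rewrite ex ec e1 e2.
  + apply: Or32 => y; suff -> : x = topL by apply: topL_le.
    by apply: val_inj; rewrite ex ec e1 e2.
  + by apply: Or33; exact: (same_item ic ex ex).
  + by apply: Or33; exact: (same_item ic ex ex).
- move=> o x y /ltL; case ex: (val (x : carrierL)) => [[c i] r].
  case ey: (val (y : carrierL)) => [[c' i'] r'].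
  have vx := valP (x : carrierL); have vy := valP (y : carrierL).
  rewrite ex in vx; rewrite ey in vy.
  move=> /=/orP[cc|/andP[/eqP ec h]].
    right; have [q [iq lq cq qc]] := item_between o vx vy cc.
    exists (fun i => pt q i [::]); split; first exact: pat_label.
      by apply/ltL; rewrite ex val_pt ?(valid_item iq lq) //= cq.
    by apply/ltL; rewrite ey val_pt ?(valid_item iq lq) //= qc.
  left; subst c'; case: (boolP (inner c)) => ic; first exact: same_item ic ex ey.
  case/valid_inv: vx => [[_ [i0 r0]]|[]|[]]; try by rewrite (negbTE ic).
  case/valid_inv: vy => [[_ [i0' r0']]|[]|[]]; try by rewrite (negbTE ic).
  by move: h; rewrite i0 i0' r0 r0'.
- move=> c c' /pat_start_group[q [w [iq lw e0]]] /pat_start_group[q' [w' [iq' lw' e0']]].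
  rewrite e0 e0' => h.
  have qq : q != q' by apply/eqP => e; rewrite e in h; case: (ltxx h).
  have [n hn] := item_bits_neq lw lw' qq.
  exists (mkseq (item_bits q) n.+1), (mkseq (item_bits q') n.+1).
  exists (fun i => pt q i [::]), (fun i => pt q' i [::]); split=> //.
  + by rewrite !size_mkseq.
  + move=> e; have := congr1 (fun s => nth false s n) e; rewrite !nth_mkseq // => e'.
    by rewrite e' eqxx in hn.
  + exact: pat_group lw.
  + exact: pat_group lw'.
- move=> c c' /pat_start_zero[q [iq ln e0]] /pat_start_zero[q' [iq' ln' e0']].
  rewrite e0 e0'; have v := valid_item iq ln (leq0n _); have v' := valid_item iq' ln' (leq0n _).
  move=> /(iffLR (tltL v v')) /=; rewrite andbF orbF => qq.
  have [p [ip lp h1 h2]] := item_between (Some [::]) v v' qq.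
  have vp := valid_item ip lp (leq0n _).
  exists (fun i => pt p i [::]); split; first exact: pat_label.
    by apply/tltL => //=; rewrite h1.
  by apply/tltL => //=; rewrite h2.
Qed.

Theorem theorem6p17 :
  exists phi : formula,
    sentence phi /\
    is_Pi 4 phi /\
    (forall M : structure, models M phi -> linear_order M) /\
    (exists M : structure, countable_structure M /\ models M phi) /\
    (forall M : structure, countable_structure M -> models M phi ->
       scott_complexity_at_least (CPi 6) M /\
       ~ has_scott_sentence_in M (CSigma 6)).
Proof.
have [phi [h1 h2 h3]] := theory_Pi4; exists phi; do 2!split=> //; split.
  by move=> M /h3; apply: th_lin.
split; first by exists L; split; [exact: countableL|apply/h3; exact: theoryL].
move=> M cM /h3 th; split=> [d nd hd|hd]; last first.
  by have := no_scott_sentence th cM hd.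
by have := no_scott_sentence th cM hd; case: d nd {hd} => n /=; lia.
Qed.
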